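(* Let $K$ be a number field of degree $n=[K:\mathbb{Q}]$ whose ring of integers $\mathcal{O}$ is a principal ideal domain, let $m\ge 2$ be an integer, and let $S\subseteq \mathcal{O}^m$ be a finite set. Then, for every $\mathbb{Z}$-basis $\mathbb{E}$ of $\mathcal{O}$, the density of $V(S)$ along the averaging sets $C[L,\mathbb{E}]$ (as $L\to\infty$), and likewise along the averaging sets $B[R,\mathbb{E}]$ (as $R\to\infty$), exists, and in each case it is given by $$D(V(S))=\prod_{\mathfrak{p}\in\mathcal{P}_{\mathcal{O}}}\left(1-\frac{s(\mathfrak{p})}{N(\mathfrak{p})^m}\right).$$
   Context: For $\mathbf{a}=(a_1,\dots,a_m)\in\mathcal{O}^m$, $\gcd(\mathbf{a})$ denotes the ideal $\gcd((a_1),\dots,(a_m))$, i.e. the smallest ideal of $\mathcal{O}$ containing all the principal ideals $(a_i)$. For a finite set $S\subseteq\mathcal{O}^m$, $$V(S)=\{\mathbf{z}\in\mathcal{O}^m : \gcd(\mathbf{z}-\mathbf{x})=\mathcal{O}\ \text{for all } \mathbf{x}\in S\}.$$ $\mathcal{P}_{\mathcal{O}}$ is the set of nonzero prime ideals of $\mathcal{O}$; $N(\mathfrak{p})=|\mathcal{O}/\mathfrak{p}|$; $\pi_{\mathfrak{p}}:\mathcal{O}^m\to(\mathcal{O}/\mathfrak{p})^m$ is the natural projection and $s(\mathfrak{p})=|\pi_{\mathfrak{p}}(S)|$. For a $\mathbb{Z}$-basis $\mathbb{E}=\{e_1,\dots,e_n\}$ of $\mathcal{O}$ put $$C[L,\mathbb{E}]=\Big\{\sum_{i=1}^n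 a_ie_i : a_i\in[-L,L]\cap\mathbb{Z}\Big\}\ (L\in\mathbb{N}),\qquad B[R,\mathbb{E}]=\Big\{\sum_{i=1}^n a_ie_i : a_i\in\mathbb{Z},\ a_1^2+\dots+a_n^2\le R^2\Big\}\ (R>0).$$ Here $\mathrm{vol}(C[L,\mathbb{E}])=(2L)^n$ and $\mathrm{vol}(B[R,\mathbb{E}])$ is the Lebesgue volume of the Euclidean ball of radius $R$ in $\mathbb{R}^n$. The density of $T\subseteq\mathcal{O}^m$ along the sets $A=C[L,\mathbb{E}]$ (resp. $A=B[R,\mathbb{E}]$) is the limit of $|A^m\cap T|/\mathrm{vol}(A)^m$ as $L\to\infty$ (resp. $R\to\infty$), when it exists; it is written $D(T)$ when it is independent of the basis $\mathbb{E}$. *)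

(* Defs.v *)
From HB Require Import structures.
From mathcomp Require Import all_boot all_order all_algebra all_field.
From mathcomp Require Import ring_quotient generic_quotient.
From mathcomp Require Import finmap.
From mathcomp Require Import all_classical all_reals all_analysis.
From mathcomp Require Import showcase.summability.

Set Implicit Arguments.
Unset Strict Implicit.
Unset Printing Implicit Defensive.

Import Order.TTheory GRing.Theory Num.Theory.
Import numFieldNormedType.Exports.

Local Open Scope classical_set_scope.
Local Open Scope ring_scope.

(* A number field is a fieldExtType rat, which is finite-dimensional over rat;
   ringint K is its ring of integers. *)
Definition integral_pred (K : fieldExtType rat) : {pred K} :=
  fun x => `[< integralOver (intr : int -> K) x >].
Arguments integral_pred : clear implicits.

Lemma integral_pred_subring (K : fieldExtType rat) :
  subring_closed (integral_pred K).
Proof.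
split=> [|x y|x y]; rewrite !unfold_in.
- by apply/asboolP/integral1.
- by move=> /asboolP hx /asboolP hy; apply/asboolP/integral_sub.
- by move=> /asboolP hx /asboolP hy; apply/asboolP/integral_mul.
Qed.

HB.instance Definition _ (K : fieldExtType rat) :=
  GRing.isSubringClosed.Build K (integral_pred K) (integral_pred_subring K).

Record ringint (K : fieldExtType rat) :=
  Ringint { ringint_val : K; _ : integral_pred K ringint_val }.

HB.instance Definition _ (K : fieldExtType rat) :=
  [isSub for @ringint_val K].
HB.instance Definition _ (K : fieldExtType rat) :=
  [Choice of ringint K by <:].
HB.instance Definition _ (K : fieldExtType rat) :=
  [SubChoice_isSubComNzRing of ringint K by <:].

(* Ideals as sets.  Unlike the library's idealr, the unit ideal is allowed. *)
Definition is_ideal (A : comNzRingType) (I : set A) : Prop :=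
  [/\ I 0, (forall x y, I x -> I y -> I (x + y))
    & forall a x, I x -> I (a * x)].

Definition principal (A : comNzRingType) (a : A) : set A :=
  [set a * x | x in [set: A]].

(* The integral-domain part of "principal ideal domain" is automatic for the
   subring ringint K of the field K. *)
Definition principal_ideal_ring (A : comNzRingType) : Prop :=
  forall I : set A, is_ideal I -> exists a, I = principal a.

Definition gcd_ideal (A : comNzRingType) (m : nat) (a : 'rV[A]_m) : set A :=
  smallest (@is_ideal A) (\bigcup_i principal (a 0 i)).

(* The set V(S). *)
Definition visible (A : comNzRingType) (m : nat) (S : set 'rV[A]_m) :
  set 'rV[A]_m :=
  [set z | forall x, S x -> gcd_ideal (z - x) = [set: A]].

Definition nonzero_primes (A : comNzRingType) : set (set A) :=
  [set p | [/\ is_ideal p, ~ p 1, (forall x y, p (x * y) -> p x \/ p y)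
             & exists2 x, p x & x != 0]].
Arguments nonzero_primes : clear implicits.

(* A nonzero prime ideal as a boolean predicate carrying the library's idealr
   structure, so that its quotient ring is the library's {ideal_quot _}. *)
Definition prime_pred (A : comNzRingType) (p : nonzero_primes A) : A -> bool :=
  fun x => x \in val p.

Lemma prime_pred_closed (A : comNzRingType) (p : nonzero_primes A) :
  idealr_closed (prime_pred p).
Proof.
have [[p0 pD pM] p1 _ _] := set_valP p.
split; rewrite ?/prime_pred ?unfold_in; first exact/mem_set.
  by apply/negP => /set_mem.
move=> a x y /set_mem px /set_mem py; apply/mem_set.
by apply: pD py; apply: pM.
Qed.

HB.instance Definition _ (A : comNzRingType) (p : nonzero_primes A) :=
  isIdealr.Build A (prime_pred p) (prime_pred_closed p).

Definition prime_idealr_of (A : comNzRingType) (p : nonzero_primes A) :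
    idealr A :=
  Idealr.clone A (prime_pred p) _.

Definition residue_ring (A : comNzRingType) (p : nonzero_primes A) :
    comNzRingType :=
  {ideal_quot (prime_idealr_of p)}.

(* fset_set is empty on infinite sets; card is only meaningful on finite sets,
   such as the residue rings of a ring of integers at nonzero primes. *)
Definition card (T : choiceType) (X : set T) : nat := #|` fset_set X|.

Definition abs_norm (A : comNzRingType) (p : nonzero_primes A) : nat :=
  card [set: residue_ring p].

Definition proj_mod (A : comNzRingType) (m : nat) (p : nonzero_primes A) :
    'rV[A]_m -> 'rV[residue_ring p]_m :=
  map_mx (\pi_{ideal_quot (prime_idealr_of p)}%qT : A -> residue_ring p).

(* The number s(p) of residue classes mod p met by S. *)
Definition residues (A : comNzRingType) (m : nat) (S : set 'rV[A]_m)
    (p : nonzero_primes A) : nat :=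
  card (proj_mod p @` S).

Definition euler_factor (R : realType) (A : comNzRingType) (m : nat)
    (S : set 'rV[A]_m) (p : nonzero_primes A) : R :=
  1 - (residues S p)%:R / (abs_norm p)%:R ^+ m.

(* Unordered infinite products: limits of the finite partial products along
   the directed set of finite subsets of the index type. *)
Definition partial_prod (R : realType) (I : choiceType) (f : I -> R)
    (J : {fset I}) : R := \prod_(i <- J) f i.

Definition infprod (R : realType) (I : choiceType) (f : I -> R) : R :=
  lim (partial_prod f @ totally).

Definition infprod_cvg (R : realType) (I : choiceType) (f : I -> R) : Prop :=
  cvg (partial_prod f @ totally).

Definition is_Zbasis (V : zmodType) (n : nat) (E : n.-tuple V) : Prop :=
  (forall x, exists a : 'I_n -> int, x = \sum_i tnth E i *~ a i) /\
  (forall a : 'I_n -> int, \sum_i tnth E i *~ a i = 0 -> forall i, a i = 0).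

(* The averaging sets C[L, E] and B[r, E]. *)
Definition cube (V : zmodType) (n : nat) (E : n.-tuple V) (L : nat) : set V :=
  [set x | exists2 a : 'I_n -> int,
     (forall i, - L%:Z <= a i <= L%:Z) & x = \sum_i tnth E i *~ a i].

Definition ball_pts (R : realType) (V : zmodType) (n : nat) (E : n.-tuple V)
    (r : R) : set V :=
  [set x | exists2 a : 'I_n -> int,
     \sum_i (a i)%:~R ^+ 2 <= r ^+ 2 & x = \sum_i tnth E i *~ a i].

(* Lebesgue measure on R^n as an iterated product measure; it is meaningful on
   Borel sets, in particular on Euclidean balls. *)
Fixpoint lebesgue_tuple (R : realType) (n : nat) :
    set (n.-tuple R) -> \bar R :=
  if n is n'.+1 then
    fun X => (lebesgue_measure \x @lebesgue_tuple R n')%E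
               [set t : R * n'.-tuple R | X [tuple of t.1 :: t.2]]
  else fun X => \d_([tuple] : 0.-tuple R) X.

Definition ball_vol (R : realType) (n : nat) (r : R) : R :=
  fine (lebesgue_tuple [set t : n.-tuple R | \sum_i tnth t i ^+ 2 <= r ^+ 2]).

(* The m-fold Cartesian power of B. *)
Definition rV_in (V : zmodType) (m : nat) (B : set V) : set 'rV[V]_m :=
  [set z | forall i, B (z 0 i)].

(* (2L)^n is the volume of the real cube [-L, L]^n, not the cardinality of
   cube E L. *)
Definition density_cube (R : realType) (V : zmodType) (n m : nat)
    (E : n.-tuple V) (T : set 'rV[V]_m) (D : R) : Prop :=
  (fun L : nat => (card (rV_in (cube E L) `&` T))%:R / ((2 * L)%:R ^+ n) ^+ m)
    @ \oo --> D.

Definition density_ball (R : realType) (V : zmodType) (n m : nat)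
    (E : n.-tuple V) (T : set 'rV[V]_m) (D : R) : Prop :=
  (fun r : R => (card (rV_in (ball_pts E r) `&` T))%:R / ball_vol n r ^+ m)
    @ +oo --> D.

(* Main.v *)
From mathcomp Require Import all_boot all_order all_algebra all_field.
From mathcomp Require Import ring_quotient generic_quotient finmap.
From mathcomp Require Import all_classical all_reals all_analysis.
From mathcomp Require Import measurable_realfun showcase.summability.
From mathcomp Require Import zify ring lra.
Require Import Defs.

Set Implicit Arguments.
Unset Strict Implicit.
Unset Printing Implicit Defensive.

Import Order.TTheory GRing.Theory Num.Theory.
Import numFieldNormedType.Exports.

Local Open Scope classical_set_scope.
Local Open Scope ring_scope.

(* The condition modulo finitely many primes has the density predicted by the
   partial Euler product: the averaging sets are asymptotically invariant under
   translation, and by the Chinese remainder theorem the residue classes modulo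
   a further prime are translates of each other inside the set already
   obtained, hence share its density equally.

   The remaining primes matter little.  If x is a nonzero element of a prime p
   with coordinates at most d, dividing by x with remainder shows
   N(p) <= (C d)^n; so points of a cube that are congruent modulo p are
   separated by about N(p)^(1/n), and a class modulo p meets the cube of side L
   in O(L^n / N(p)) points, or in a single one when N(p) exceeds (2 C L)^n.  At
   most n primes have a given residue characteristic q <= N(p), so the sum of
   N(p)^-m over the primes with q > Y is at most n / Y.

   For balls, the number of lattice points is compared with the iterated
   Lebesgue measure one coordinate at a time. *)

(** * Cardinalities *)

(** For z outside [S], a proper gcd ideal of z - x lies in a maximal ideal, which is nonzero because
    z - x is. So [visible S] is contained in [visible_mod S J] for every finite set J of primes, and
    differs from it only by points of [S] and by points congruent to some x in [S] modulo a prime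
    outside J. The obstacle is that infinitely many primes lie outside J, while equidistribution
    modulo p gives no error term uniform in p. Each class must therefore be counted with a constant
    independent of p. Once N(p) is so large that a class has a single point in the cube, that point
    is x itself. Such primes contribute only points of [S], which have density zero. This leaves
    finitely many primes per cube, so a union bound applies, and m >= 2 makes the sum of q^-m
    converge. Equidistribution is derived from translations rather than from counting classes in
    boxes, so that cubes and balls can share one argument. In the tail estimate a ball is replaced
    by a cube around it, at the cost of a constant factor. *)

Lemma card_inj_le (T U : choiceType) (X : set T) (Y : set U) (f : T -> U) :
  finite_set Y -> (forall x, X x -> Y (f x)) ->
  (forall x y, X x -> X y -> f x = f y -> x = y) ->
  finite_set X /\ (card X <= card Y)%N.
Proof.
move=> finY XY finj.
have fiX : {in X &, injective f} by move=> x y /set_mem ? /set_mem ?; exact: finj.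
have finX : finite_set X.
  apply: (card_le_finite _ finY); apply: (@card_le_trans _ _ _ (f @` X)).
    by have /card_eqPle[] := inj_card_eq fiX.
  by apply: subset_card_le => _ [x Xx <-]; exact: XY.
split=> //; rewrite /card.
have -> : #|` fset_set X| = #|` (f @` fset_set X)%fset|.
  rewrite card_in_imfset//= => x y.
  by rewrite !in_fset_set// => /set_mem Xx /set_mem Xy; exact: finj.
apply: fsubset_leq_card; apply/fsubsetP => y /imfsetP[x /= xX ->].
by move: xX; rewrite !in_fset_set// => /set_mem Xx; apply/mem_set/XY.
Qed.

Lemma card_sub (T : choiceType) (X Y : set T) :
  finite_set Y -> X `<=` Y -> (card X <= card Y)%N.
Proof. by move=> fY XY; case: (@card_inj_le _ _ X Y id fY). Qed.

Lemma card_finType (T : finType) : card [set: T] = #|T|.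
Proof.
rewrite /card cardE; apply: perm_size; apply: uniq_perm => [||x]; rewrite ?enum_uniq ?fset_uniq//.
by rewrite mem_enum; apply/idP; rewrite in_fset_set ?mem_set //; exact: finite_finset.
Qed.

Lemma card0 (T : choiceType) : card (set0 : set T) = 0%N.
Proof. by rewrite /card fset_set0 cardfs0. Qed.

Lemma card_setU_le (T : choiceType) (X Y : set T) :
  finite_set X -> finite_set Y -> (card (X `|` Y) <= card X + card Y)%N.
Proof.
move=> fX fY; rewrite /card fset_setU//.
by rewrite cardfsU leq_subr.
Qed.

Lemma card_fibers (T : choiceType) (U : choiceType) (X : set T) (f : T -> U)
    (s : seq U) : finite_set X -> uniq s -> (forall x, X x -> f x \in s) ->
  card X = (\sum_(u <- s) card (X `&` f @^-1` [set u]))%N.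
Proof.
elim: s X => [|u s IH] X fX /= us Xs.
  rewrite big_nil (_ : X = set0) ?card0//.
  by apply/seteqP; split=> // x /Xs.
move: us => /andP[uns us]; rewrite big_cons.
have fD : finite_set (X `\` f @^-1` [set u]) by exact: finite_setD.
have fI : finite_set (X `&` f @^-1` [set u]) by exact: finite_setIl.
have {1}-> : X = (X `&` f @^-1` [set u]) `|` (X `\` f @^-1` [set u]).
  by rewrite setUIDK.
rewrite /card fset_setU// cardfsU -fset_setI//.
rewrite [_ `&` (_ `\` _)](_ : _ = set0); last first.
  by apply/seteqP; split=> // x [[? ?] []].
rewrite fset_set0 cardfs0 subn0; congr (_ + _)%N.
rewrite -[LHS]/(card _) (IH _ fD us); last first.
  by move=> x [Xx /= /eqP fxu]; have := Xs x Xx; rewrite inE (negPf fxu).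
rewrite [LHS]big_seq [RHS]big_seq; apply: eq_bigr => v vs; congr card.
apply/seteqP; split=> x; first by move=> [[? ?] ?].
move=> [Xx fx]; split=> //; split=> //= fxu; move: fx => /= fx.
by move: uns; rewrite -fxu fx vs.
Qed.

Lemma card_bigcup_le (T : choiceType) (U : eqType) (s : seq U) (X : U -> set T) :
  (forall u, u \in s -> finite_set (X u)) ->
  finite_set (\bigcup_(u in [set` s]) X u) /\
  (card (\bigcup_(u in [set` s]) X u) <= \sum_(u <- s) card (X u))%N.
Proof.
elim: s => [|u s IH] fX.
  by rewrite big_nil set_nil bigcup_set0; split; [exact: finite_set0|rewrite card0].
have [fs cs] : finite_set (\bigcup_(v in [set` s]) X v) /\
    (card (\bigcup_(v in [set` s]) X v) <= \sum_(v <- s) card (X v))%N.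
  by apply: IH => v vs; apply: fX; rewrite inE vs orbT.
have fu : finite_set (X u) by apply: fX; rewrite mem_head.
have -> : \bigcup_(v in [set` u :: s]) X v =
    X u `|` \bigcup_(v in [set` s]) X v.
  apply/seteqP; split=> x.
    by move=> [v /=]; rewrite inE => /predU1P[->|vs Xv]; [left|right; exists v].
  move=> [Xu|[v vs Xv]]; first by exists u => //=; exact: mem_head.
  by exists v => //=; rewrite inE vs orbT.
rewrite big_cons; split; first by rewrite finite_setU.
by apply: leq_trans (card_setU_le fu fs) _; rewrite leq_add2l.
Qed.

Lemma card_rV_in (V : zmodType) (m : nat) (X : set V) :
  finite_set X -> finite_set (@rV_in V m X) /\ card (@rV_in V m X) = (card X ^ m)%N.
Proof.
move=> fX.
pose F := {ffun 'I_m -> fset_set X}.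
have cF : card [set: F] = (card X ^ m)%N.
  by rewrite card_finType card_ffun card_ord -cardfE.
have memX (z : 'rV[V]_m) i : rV_in X z -> z 0 i \in fset_set X.
  by move=> Xz; rewrite in_fset_set//; apply/mem_set/Xz.
have [fr le1] : finite_set (@rV_in V m X) /\
    (card (@rV_in V m X) <= card [set: F])%N.
  (* The entries of an element [z0] of the power provide the default values that [insubd] needs.
     Without such an element the power is empty and the upper bound is trivial. *)
  have [[z0 Xz0]|/forallNP Xn] := pselect (exists z, @rV_in V m X z).
    have d i : fset_set X := [` memX z0 i Xz0]%fset.
    apply: (@card_inj_le _ _ _ _
      (fun z : 'rV[V]_m => [ffun i => insubd (d i) (z 0 i)] : F)) => //; first exact: finite_finset.
    move=> x y Xx Xy /ffunP xy; apply/rowP => i.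
    have := congr1 val (xy i); rewrite !ffunE !insubdK//; exact: memX.
  have -> : @rV_in V m X = set0 by apply/seteqP; split=> // x /Xn.
  by rewrite card0; split; first exact: finite_set0.
split=> //; apply/eqP; rewrite eqn_leq -cF le1 /=.
have [] // := @card_inj_le _ _ [set: F] (@rV_in V m X)
  (fun g : F => \row_i val (g i)) fr.
  move=> g _ i; rewrite mxE; have := valP (g i).
  by rewrite in_fset_set// => /set_mem.
move=> x y _ _ /rowP xy; apply/ffunP => i; apply/val_inj.
by have := xy i; rewrite !mxE.
Qed.

Lemma card_setDK (T : choiceType) (X Y : set T) :
  finite_set X -> Y `<=` X -> card X = (card Y + card (X `\` Y))%N.
Proof.
move=> fX YX; have fY := sub_finite_set YX fX.
rewrite {3}/card fset_setD// cardfsD -fset_setI// (setIidr YX).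
by rewrite subnKC//; exact: card_sub.
Qed.

(** * Averages along asymptotically invariant sets *)

Lemma cvg_sum_seq (R : realType) (I : Type) (F : set_system I) (J : eqType)
    (s : seq J) (P : pred J) (g : J -> I -> R) (l : J -> R) : Filter F ->
  (forall j, P j -> g j @ F --> l j) ->
  (fun i => \sum_(j <- s | P j) g j i) @ F --> \sum_(j <- s | P j) l j.
Proof.
move=> FF gl; elim: s => [|j s IH].
  by rewrite big_nil; under eq_fun do rewrite big_nil; exact: cvg_cst.
rewrite big_cons; under eq_fun do rewrite big_cons.
by have [Pj|//] := boolP (P j); apply: cvgD => //; exact: gl.
Qed.

Section Averaging.
Context {R : realType} {V : zmodType} {I : Type}.
Variables (F : set_system I) (B : I -> set V) (v : I -> R).
Context {FF : ProperFilter F}.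

Definition average (T : set V) (i : I) : R := (card (B i `&` T))%:R / v i.

Hypothesis finB : forall i, finite_set (B i).
Hypothesis v_gt0 : \forall i \near F, 0 < v i.
Hypothesis averageT : average setT @ F --> (1 : R).
(** Asymptotic invariance, phrased with an enlarged index: [B (t i)] contains both [B i] and its
    translate, at no asymptotic cost in size. For cubes and balls, [t] adds a constant to the
    radius. *)
Hypothesis folner : forall w : V, exists2 t : I -> I,
  (fun i => (card (B (t i)))%:R / v i) @ F --> (1 : R) &
  \forall i \near F, B i `<=` B (t i) /\ (forall z, B i z -> B (t i) (z + w)).

Lemma average_fibers (U : choiceType) (f : V -> U) (T : set V) (s : seq U) i :
  uniq s -> (forall z, T z -> f z \in s) ->
  average T i = \sum_(u <- s) average (T `&` f @^-1` [set u]) i.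
Proof.
move=> us Ts; rewrite /average.
have fX : finite_set (B i `&` T) by exact: finite_setIl.
rewrite (card_fibers (f := f) fX us); last by move=> x [_ /Ts].
rewrite natr_sum mulr_suml; apply: eq_bigr => u _.
by rewrite setIA.
Qed.

(** Translation by [w] maps the points of [T] in [B i] injectively into [B (t i)]. The images that
    leave [B i] lie in the shell between the two sets, whose normalized size is [e] and tends to 1 -
    1 = 0. *)
Lemma average_shift_le (T : set V) (w : V) : exists2 e : I -> R,
  e @ F --> (0 : R) &
  \forall i \near F, average T i <= average [set z | T (z - w)] i + e i.
Proof.
have [t ct tP] := folner w.
exists (fun i => (card (B (t i)))%:R / v i - average setT i).
  by rewrite -(subrr (1 : R)); apply: cvgB.
near=> i.
have [Bt Bw] : B i `<=` B (t i) /\ (forall z, B i z -> B (t i) (z + w)).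
  by near: i.
have vi : 0 < v i by near: i.
rewrite /average setIT -mulrBl -mulrDl ler_pM2r ?invr_gt0//.

set T' := [set z | T (z - w)].
have le : (card (B i `&` T) + card (B i) <=
    card (B i `&` T') + card (B (t i)))%N.
  have fD : finite_set (B (t i) `\` B i) by exact: finite_setD.
  rewrite (card_setDK (finB (t i)) Bt) addnCA addnC leq_add2l.
  have h : (card (B i `&` T) <= card (B (t i) `&` T'))%N.
    apply: (card_inj_le (f := fun z => z + w) _ _ _).2.
    - exact: finite_setIl.
    - by move=> z [Bz Tz]; split; [exact: Bw|rewrite /T' /= addrK].
    - by move=> x y _ _ /addIr.
  apply: leq_trans h _; apply: leq_trans (card_setU_le _ fD).
    apply: card_sub; first by rewrite finite_setU; split=> //; exact: finite_setIl.
    move=> z [Bz Tz]; have [Bi|nBi] := pselect (B i z); first by left.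
    by right.
  exact: finite_setIl.
by rewrite addrA lerBrDr -!natrD ler_nat.
Unshelve. all: by end_near. Qed.

(** The missing inequality is the one-sided estimate for the translated set, moved back by [- w]. *)
Lemma average_shift (T : set V) (w : V) :
  (fun i => average T i - average [set z | T (z - w)] i) @ F --> (0 : R).
Proof.
have [e e0 le] := average_shift_le T w.
have [e' e'0] := average_shift_le [set z | T (z - w)] (- w).
have -> : [set z | [set z | T (z - w)] (z - - w)] = T.
  by apply/funext => z /=; rewrite opprK addrK.
move=> le'.
apply: (@squeeze_cvgr _ _ _ _ (fun i => - e' i) e).
- near=> i; apply/andP; split.
    by rewrite lerBrDr addrC lerBlDr; near: i.
  by rewrite lerBlDr addrC; near: i.
- by rewrite -(oppr0 R); exact: cvgN.
- exact: e0.
Unshelve. all: by end_near. Qed.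

(* The fibers of [f] inside [T] are translates of each other, so that they all
   get the same share of the density of [T]. *)
Lemma average_equidistribution (U : choiceType) (f : V -> U) (T : set V)
    (c : R) (W : set U) :
  finite_set [set: U] ->
  (forall u u', exists w, forall z,
     (T z /\ f z = u) <-> (T (z + w) /\ f (z + w) = u')) ->
  average T @ F --> c ->
  average (T `&` f @^-1` W) @ F --> c * ((card W)%:R / (card [set: U])%:R).
Proof.
move=> fU trans Tc.
pose s : seq U := fset_set [set: U].
have us : uniq s by exact: fset_uniq.
have sT u : u \in s by rewrite in_fset_set//; apply/mem_set.
pose T_ u := T `&` f @^-1` [set u].
pose N : R := (card [set: U])%:R.
have Ns : N = (size s)%:R by [].
have cvgu u : average (T_ u) @ F --> c / N.
  have N0 : N != 0.
    by rewrite Ns pnatr_eq0 -lt0n; move: (sT u); case: (s).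
  have diff u' : (fun i => average (T_ u) i - average (T_ u') i) @ F --> (0 : R).
    have [w wP] := trans u u'.
    have := average_shift (T_ u) w.
    have -> // : [set z | T_ u (z - w)] = T_ u'.
    apply/seteqP; split=> z h; first by have := (wP (z - w)).1 h; rewrite subrK.
    by apply: (wP (z - w)).2; rewrite subrK.
  (* Since the fibers partition [T], N times the average of one fiber is the average of [T] plus its
     differences with all the fibers, and these differences vanish in the limit. *)
  have : (fun i => N^-1 * (average T i +
      \sum_(u' <- s) (average (T_ u) i - average (T_ u') i))) @ F -->
      N^-1 * (c + \sum_(u' <- s) (0 : R)).
    apply: cvgMr; apply: cvgD => //.
    by apply: cvg_sum_seq.
  rewrite big1 // addr0 mulrC; apply: cvg_trans; apply: near_eq_cvg.
  near=> i; rewrite (average_fibers (f := f) i us) // big_split /= sumrN addrCA.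
  by rewrite subrr addr0 big_const_seq count_predT iter_addr_0 -mulr_natl -Ns mulKf.
have -> : c * ((card W)%:R / N) = \sum_(u <- s | u \in W) (c / N).
  have -> : card W = count (mem W) s.
    rewrite -size_filter; apply: perm_size; apply: uniq_perm.
    - exact: fset_uniq.
    - exact: filter_uniq.
    - move=> u; rewrite mem_filter sT andbT in_fset_set//.
      exact: sub_finite_set fU.
  by rewrite big_const_seq iter_addr_0 mulrCA mulr_natl.
have -> : average (T `&` f @^-1` W) = fun i => \sum_(u <- s | u \in W) average (T_ u) i.
  apply/funext => i; rewrite (average_fibers (f := f) i us) // [LHS](bigID (mem W)) /=.
  rewrite [X in _ + X]big1 ?addr0.
    apply: eq_bigr => u /set_mem Wu; rewrite /average; congr (_%:R / _).
    congr card; congr (_ `&` _); apply/seteqP; split=> z.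
      by move=> [[Tz _] fz].
    by move=> [Tz fz]; split=> //; split => //=; rewrite fz.
  move=> u /negP uW; rewrite /average (_ : _ `&` _ = set0) ?card0 ?mul0r//.
  apply/seteqP; split=> // z [_ [[_ Wz] fz]]; apply: uW; apply/mem_set.
  by rewrite -fz.
by apply: cvg_sum_seq => u _; exact: cvgu.
Unshelve. all: by end_near. Qed.
End Averaging.

(** * Ball volumes and lattice points *)

Lemma int_itv_finite (M : nat) :
  finite_set [set a : int | - M%:Z <= a <= M%:Z] /\
  card [set a : int | - M%:Z <= a <= M%:Z] = (2 * M + 1)%N.
Proof.
set X := [set a : int | _].
pose g (k : 'I_(2 * M + 1)) : int := k%:Z - M%:Z.
have XE : X = g @` [set: 'I_(2 * M + 1)].
  apply/seteqP; split=> x; rewrite /X /=.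
    move=> h; have xM : (absz (x + M%:Z)%R < 2 * M + 1)%N by lia.
    by exists (Ordinal xM) => //; rewrite /g /=; lia.
  by move=> [[k kM] _ <-]; rewrite /g /=; lia.
have ginj : injective g by move=> j k; rewrite /g => h; apply/val_inj => /=; lia.
have fX : finite_set X by rewrite XE; apply: finite_image; exact: finite_finset.
split=> //; rewrite -[RHS]card_ord -card_finType; apply/eqP; rewrite eqn_leq.
apply/andP; split.
  pose h (x : int) : 'I_(2 * M + 1) := insubd (Ordinal (ltn_addl (2 * M) (ltnSn 0))) (absz (x + M%:Z)%R).
  apply: (@card_inj_le _ _ X [set: 'I_(2 * M + 1)] h _ _ _).2 => //; first exact: finite_finset.
  have hE x : X x -> x = (h x)%:Z - M%:Z.
    by rewrite /X /= => Xx; rewrite /h val_insubd; case: ltnP; lia.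
  by move=> x y /hE xE /hE yE hxy; rewrite xE yE hxy.
apply: (@card_inj_le _ _ [set: 'I_(2 * M + 1)] X g fX _ _).2.
  by move=> k _; rewrite XE; exists k.
by move=> j k _ _; exact: ginj.
Qed.

Section BallVolume.
Context {R : realType}.
Notation mu := (@lebesgue_measure R).

(** The parameter is the squared radius, possibly negative. Slicing at first coordinate [x] then
    just replaces [s] by [s - x ^+ 2], with the empty ball when this is negative. *)
Definition sqball (n : nat) (s : R) : set (n.-tuple R) :=
  [set t | \sum_i tnth t i ^+ 2 <= s].

Definition sqball_vol (n : nat) (s : R) : \bar R := lebesgue_tuple (@sqball n s).

Lemma sqball_volS n s :
  sqball_vol n.+1 s = (\int[mu]_x sqball_vol n (s - x ^+ 2))%E.
Proof.
rewrite /sqball_vol /= /product_measure1; apply: eq_integral => x _ /=.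
congr lebesgue_tuple; apply/seteqP; split=> t; rewrite /xsection /= !inE /sqball /=.
  by rewrite big_ord_recl /= lerBrDl; under eq_bigr do rewrite tnthS.
by rewrite big_ord_recl /= lerBrDl; under [in X in _ -> X]eq_bigr do rewrite tnthS.
Qed.

Lemma sqball_vol0 s : sqball_vol 0 s = ((0 <= s)%R%:R)%:E.
Proof.
rewrite /sqball_vol /= diracE; congr ((_ : bool)%:R%:E).
apply/idP/idP; rewrite inE /sqball /= big_ord0 //.
Qed.

Lemma sqball_vol_lt0 n s : s < 0 -> sqball_vol n s = 0%E.
Proof.
move=> s0; elim: n s s0 => [|n IH] s s0; first by rewrite sqball_vol0 leNgt s0.
rewrite sqball_volS integral0_eq// => x _; apply: IH.
by rewrite subr_lt0 (lt_le_trans s0) ?sqr_ge0.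
Qed.

Lemma sqball_vol1 s : sqball_vol 1 s = (2 * Num.sqrt s)%:E.
Proof.
have [s0|s0] := ltP s 0.
  by rewrite sqball_vol_lt0// ltr0_sqrtr// mulr0.
rewrite sqball_volS.
under eq_integral => x _ do rewrite sqball_vol0.
have -> : (\int[mu]_x ((0 <= s - x ^+ 2)%R%:R)%:E)%E =
    (\int[mu]_x (\1_(`[- Num.sqrt s, Num.sqrt s]%classic) x)%:E)%E.
  apply: eq_integral => x _; rewrite indicE; congr ((_ : bool)%:R%:E).
  rewrite mem_setE in_itv /= -ler_norml subr_ge0 -[in LHS](sqr_sqrtr s0).
  by rewrite -real_normK ?num_real// ler_pXn2r// nnegrE// sqrtr_ge0.
rewrite integral_indic//= setIT lebesgue_measure_itv /= lte_fin.
have [->|r0] := eqVneq (Num.sqrt s) 0; first by rewrite oppr0 ltxx mulr0.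
have rp : 0 < Num.sqrt s by rewrite lt_def r0 sqrtr_ge0.
rewrite gtrN// -EFinB opprK; congr EFin; ring.
Qed.

(** Up to a constant, the volume of the n-dimensional slice at [x]. For n > 0 it vanishes outside
    the ball, because the square root of a negative number is 0. *)
Definition half_chord (n : nat) (s x : R) : R := Num.sqrt (s - x ^+ 2) ^+ n.

Lemma half_chord_ge0 n s x : 0 <= half_chord n s x.
Proof. by rewrite exprn_ge0 ?sqrtr_ge0. Qed.

Lemma half_chord_continuous n (s : R) : continuous (half_chord n s).
Proof.
move=> x.
apply: (@continuous_cvg _ _ _ _ _ _ (fun y : R => y ^+ n)).
  exact: exprn_continuous.
apply: (@continuous_cvg _ _ _ _ _ _ (@Num.sqrt R)); first exact: sqrt_continuous.
apply: cvgB; first exact: cvg_cst.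
exact: exprn_continuous.
Qed.

Lemma half_chord_measurable n s : measurable_fun [set: R]
  (EFin \o half_chord n s).
Proof.
apply/measurable_EFinP; apply: continuous_measurable_fun.
exact: half_chord_continuous.
Qed.

(** For n > 0, the integral of (1 - x^2)^(n/2) over [-1, 1]: the ratio of the unit ball volumes in
    dimensions n + 1 and n. *)
Definition half_ball_int n : R := fine (\int[mu]_x (half_chord n 1 x)%:E)%E.

(** The value never matters, because the volume constant cancels in the densities. The integrand is
    at most the indicator of [-1, 1], and at least 2^-n on [-1/2, 1/2], an interval of length 1. *)
Lemma half_ball_int_gt0 n : (0 < n)%N ->
  (\int[mu]_x (half_chord n 1 x)%:E)%E = (half_ball_int n)%:E /\
  0 < half_ball_int n.
Proof.
move=> n0; set J := (\int[mu]_x _)%E.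
have mf := half_chord_measurable n 1.
have f0 x : (0 <= (half_chord n 1 x)%:E)%E.
  by rewrite lee_fin half_chord_ge0.
have J2 : (J <= 2%:E)%E.
  have -> : 2%:E = (\int[mu]_x (\1_(`[-1, 1]%classic : set R) x)%:E)%E :> \bar R.
    rewrite integral_indic//= setIT lebesgue_measure_itv /= lte_fin.
    by rewrite gtrN// -EFinB opprK.
  apply: ge0_le_integral => //.
    exact/measurable_EFinP/measurable_indic.
  move=> x _; rewrite lee_fin indicE.
  have [xin|xout] := boolP (x \in _).
    rewrite /half_chord exprn_ile1 ?sqrtr_ge0// -[X in _ <= X]sqrtr1 ler_wsqrtr//.
    by rewrite gerBl sqr_ge0.
  rewrite /half_chord ltr0_sqrtr ?expr0n ?gtn_eqF//.
  rewrite subr_lt0 -[X in _ < X]real_normK ?num_real// expr_gt1 ?normr_ge0//.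
  by rewrite ltNge ler_norml; apply: contra xout; rewrite mem_setE in_itv.
have J1 : ((2^-1 ^+ n)%:E <= J)%E.
  have -> : (2^-1 ^+ n)%:E =
      (\int[mu]_x ((2^-1 ^+ n)%:E * (\1_(`[- 2^-1, 2^-1]%classic : set R) x)%:E))%E :> \bar R.
    rewrite ge0_integralZl//=.
    - rewrite integral_indic//= setIT lebesgue_measure_itv /= lte_fin.
      rewrite gtrN// -EFinB opprK -[X in (_ * X%:E)%E](_ : 1 = _) ?mule1//.
      lra.
    - exact/measurable_EFinP/measurable_indic.
  apply: ge0_le_integral => //.
  - apply: measurable_funeM; exact/measurable_EFinP/measurable_indic.
  move=> x _; rewrite -EFinM lee_fin indicE.
  have [xin|xout] := boolP (x \in _); last by rewrite mulr0 half_chord_ge0.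
  rewrite mulr1 /half_chord lerXn2r ?nnegrE ?sqrtr_ge0//.
  rewrite -[X in X <= _]ger0_norm// -sqrtr_sqr ler_wsqrtr//.
  move: xin; rewrite mem_setE in_itv /= => /andP[x1 x2]; nra.
have Jfin : J \is a fin_num.
  by rewrite ge0_fin_numE ?(le_lt_trans J2) ?ltry// integral_ge0.
rewrite /half_ball_int -/J fineK//; split=> //.
by rewrite -lte_fin fineK// (lt_le_trans _ J1)// lte_fin exprn_gt0.
Qed.

(** Substitution x = r y with r = sqrt(s): the integrand contributes r^n and the differential one
    more factor r. *)
Lemma half_ball_scaling n (s : R) : 0 < s -> (0 < n)%N ->
  (\int[mu]_x (half_chord n s x)%:E)%E =
  (Num.sqrt s ^+ n.+1 * half_ball_int n)%:E.
Proof.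
move=> s0 n0; set r := Num.sqrt s.
have r0 : 0 < r by rewrite sqrtr_gt0.
have rs : s = r ^+ 2 by rewrite sqr_sqrtr// ltW.
have dF x : is_derive x (1:R) (fun y : R => r * y) r.
  have := @is_deriveZ _ _ _ id r x 1 1 (is_derive_id x 1).
  by rewrite scaler1.
have F' : derive1 (fun y : R => r * y) = cst r.
  by apply/funext => x; rewrite derive1E; apply: derive_val.
rewrite (@increasing_ge0_integration_by_substitutionT _ (fun y => r * y)); last 9 first.
- by move=> x y xy; rewrite ltr_pM2l.
- by rewrite F'; exact: cst_continuous.
- by rewrite F'; exact: is_cvg_cst.
- by rewrite F'; exact: is_cvg_cst.
- by move=> x; have [] := dF x.
- exact: gt0_cvgMrNy.
- exact: gt0_cvgMry.
- exact: half_chord_continuous.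
- exact: half_chord_ge0.
rewrite F'.
have [Jn _] := half_ball_int_gt0 n0.
rewrite EFinM -Jn -ge0_integralZl//.
- apply: eq_integral => x _ /=; rewrite -EFinM; congr EFin.
  rewrite -[LHS]/(half_chord n s (r * x) * r) /half_chord [(r * x) ^+ 2]exprMn rs.
  rewrite -[X in X - r ^+ 2 * _]mulr1 -mulrBr sqrtrM ?sqr_ge0// sqrtr_sqr.
  by rewrite gtr0_norm// exprMn [r ^+ n.+1]exprSr mulrAC.
- exact: half_chord_measurable.
- by move=> x _; rewrite lee_fin half_chord_ge0.
- by rewrite lee_fin exprn_ge0// ltW.
Qed.

(** The volume of the unit ball. Dimension 1 is entered by hand: [half_chord 0] is constantly 1, so
    its integral over the line is infinite and the recursion cannot start at 0. *)
Fixpoint ball_const (n : nat) : R :=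
  if n is n'.+1 then (if n' is 0%N then 2 else ball_const n' * half_ball_int n')
  else 1.

Lemma ball_const_gt0 n : 0 < ball_const n.
Proof.
elim: n => [|[|n] IH]//.
by rewrite mulr_gt0 //; have [] := @half_ball_int_gt0 n.+1.
Qed.

Lemma sqball_volE n s :
  sqball_vol n.+1 s = (ball_const n.+1 * Num.sqrt s ^+ n.+1)%:E.
Proof.
elim: n s => [|n IH] s; first exact: sqball_vol1.
have [s0|s0] := leP s 0.
  rewrite ler0_sqrtr// expr0n mulr0 sqball_volS integral0_eq// => x _.
  rewrite IH [Num.sqrt (s - _)]ler0_sqrtr ?expr0n ?mulr0//.
  by rewrite subr_le0 (le_trans s0)// sqr_ge0.
rewrite sqball_volS; under eq_integral do rewrite IH EFinM.
rewrite ge0_integralZl//.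
- by rewrite half_ball_scaling// -EFinM /= -mulrA [half_ball_int _ * _]mulrC.
- exact: half_chord_measurable.
by rewrite lee_fin ltW// ball_const_gt0.
Qed.

Lemma sqball_vol_le n s s' : s <= s' -> (sqball_vol n s <= sqball_vol n s')%E.
Proof.
case: n => [|n] ss; last first.
  rewrite !sqball_volE lee_fin ler_pM2l ?ball_const_gt0//.
  by rewrite lerXn2r ?nnegrE ?sqrtr_ge0// ler_wsqrtr.
rewrite !sqball_vol0 lee_fin ler_nat.
by case: (leP 0 s) => // /le_trans ->.
Qed.

Lemma sqball_vol_ge0 n s : (0 <= sqball_vol n s)%E.
Proof.
case: n => [|n]; first by rewrite sqball_vol0 lee_fin.
by rewrite sqball_volE lee_fin mulr_ge0 ?exprn_ge0 ?sqrtr_ge0// ltW// ball_const_gt0.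
Qed.

Lemma sqball_slice_measurable n s :
  measurable_fun [set: R] (fun x : R => sqball_vol n (s - x ^+ 2)).
Proof.
case: n => [|n]; last first.
  under eq_fun do rewrite sqball_volE EFinM.
  by apply: measurable_funeM; exact: half_chord_measurable.
have -> : (fun x : R => sqball_vol 0 (s - x ^+ 2)) =
    EFin \o (\1_[set x : R | 0 <= s - x ^+ 2] : R -> R).
  apply/funext => x; rewrite sqball_vol0 /= indicE; congr ((_ : bool)%:R%:E).
  by apply/idP/idP; rewrite inE.
apply/measurable_EFinP/measurable_indic.
have mg : measurable_fun [set: R] (fun x : R => s - x ^+ 2).
  apply: continuous_measurable_fun => x; apply: cvgB; first exact: cvg_cst.
  exact: exprn_continuous.
rewrite (_ : [set x | _] = setT `&` (fun x : R => s - x ^+ 2) @^-1` `[0, +oo[).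
  by apply: mg => //; exact: measurable_itv.
by rewrite setTI; apply/seteqP; split=> x /=; rewrite in_itv /= andbT.
Qed.

Lemma unit_steps_integral (g : R -> \bar R) (a : R) (N : nat) :
  measurable_fun [set: R] g -> (forall x, (0 <= g x)%E) ->
  (\int[mu]_(x in `[a, (a + N%:R)%R[) g x =
   \sum_(k < N) \int[mu]_(x in `[(a + k%:R)%R, (a + k.+1%:R)%R[) g x)%E.
Proof.
move=> mg g0; elim: N => [|N IH].
  by rewrite big_ord0 addr0 set_itvco0 integral_set0.
rewrite big_ord_recr /= -IH -ge0_integral_setU//; last 2 first.
- exact: measurable_funTS.
- apply/disj_set2P/seteqP; split=> // x /=; rewrite !in_itv /=.
  by move=> [/andP[_ h1] /andP[h2 _]]; rewrite ltNge h2 in h1.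
congr (\int[mu]_(x in _) _)%E; apply/seteqP; split=> x /=; rewrite !in_itv /=.
  move=> /andP[-> ->]; rewrite andbT /=.
  by case: (ltP x (a + N%:R)); [left|right].
have le : a + N%:R <= a + N.+1%:R by rewrite lerD2l ler_nat.
have le' : a <= a + N%:R by rewrite lerDl.
move=> [/andP[-> h]|/andP[h ->]] /=; first exact: lt_le_trans le.
by rewrite (le_trans le').
Qed.

Lemma unit_step_cst (a : R) k c :
  (\int[mu]_(x in `[(a + k%:R)%R, (a + k.+1%:R)%R[) (cst c%:E) x = c%:E)%E.
Proof.
rewrite integral_cst//= lebesgue_measure_itv /= lte_fin ltrD2l ltr_nat leqnn.
by rewrite -EFinB -[X in (_ * X%:E)%E](_ : 1 = _) ?mule1// -natr1; ring.
Qed.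

(** [c] is a step function on the unit intervals from [a] on. In the lattice comparison [a] is [- M]
    and [c k] counts the lattice slice with first coordinate k - M. *)
Lemma sum_le_integral (g : R -> \bar R) (c : nat -> R) (a : R) (N : nat) :
  measurable_fun [set: R] g -> (forall x, (0 <= g x)%E) ->
  (forall k, 0 <= c k) ->
  (forall k x, (k < N)%N -> a + k%:R <= x -> x < a + k.+1%:R -> ((c k)%:E <= g x)%E) ->
  ((\sum_(k < N) c k)%:E <= \int[mu]_x g x)%E.
Proof.
move=> mg g0 c0 cg.
apply: (@le_trans _ _ (\int[mu]_(x in `[a, (a + N%:R)%R[) g x)%E); last first.
  by apply: ge0_subset_integral.
rewrite unit_steps_integral// -sumEFin; apply: lee_sum => k _.
rewrite -(unit_step_cst a k (c k)); apply: ge0_le_integral => //.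
- by move=> x _; rewrite lee_fin.
- exact: measurable_funTS.
- by move=> x; rewrite /= in_itv /= => /andP[]; exact: cg.
Qed.

Lemma integral_le_sum (g : R -> \bar R) (c : nat -> R) (a : R) (N : nat) :
  measurable_fun [set: R] g -> (forall x, (0 <= g x)%E) ->
  (forall x, x < a \/ a + N%:R <= x -> g x = 0%E) ->
  (forall k x, (k < N)%N -> a + k%:R <= x -> x < a + k.+1%:R -> (g x <= (c k)%:E)%E) ->
  (\int[mu]_x g x <= (\sum_(k < N) c k)%:E)%E.
Proof.
move=> mg g0 gout gc.
have -> : (\int[mu]_x g x = \int[mu]_(x in `[a, (a + N%:R)%R[) g x)%E.
  rewrite [RHS]integral_mkcond; apply: eq_integral => x _; rewrite /patch.
  case: ifPn => //; rewrite mem_setE in_itv /= negb_and -ltNge -leNgt => /orP h.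
  exact: gout.
rewrite unit_steps_integral// -sumEFin; apply: lee_sum => k _.
rewrite -(unit_step_cst a k (c k)); apply: ge0_le_integral => //.
- exact: measurable_funTS.
- by move=> x; rewrite /= in_itv /= => /andP[]; exact: gc.
Qed.

(** * Lattice points in balls against ball volumes *)

Definition int_ball (n : nat) (s : R) : set 'rV[int]_n :=
  [set a | \sum_i (a 0 i)%:~R ^+ 2 <= s].

Definition int_ball_card (n : nat) (s : R) : nat := card (@int_ball n s).

Lemma int_ball_sub n s (M : nat) : s < M.+1%:R ^+ 2 ->
  @int_ball n s `<=` @rV_in _ n [set a : int | - M%:Z <= a <= M%:Z].
Proof.
move=> sM a sa i; rewrite /int_ball /= in sa; rewrite /= -ler_norml.
suff : (`|a 0 i|%:~R : R) < M.+1%:R by rewrite -[M.+1%:R]/(M.+1%:Z%:~R) ltr_int; lia.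
rewrite -(@ltr_pXn2r _ 2) ?nnegrE ?ler0z//.
apply: le_lt_trans sM; apply: le_trans sa.
rewrite (bigD1 i) //= intr_norm real_normK ?num_real// lerDl.
by apply: sumr_ge0 => j _; exact: sqr_ge0.
Qed.

Lemma int_ball_finite n s : finite_set (@int_ball n s).
Proof.
have sM : s < (Num.truncn s).+1%:R ^+ 2.
  apply: lt_le_trans (truncnS_gt s) _.
  by rewrite ler_eXnr// ler1n.
apply: sub_finite_set (int_ball_sub sM) _.
exact: (card_rV_in n (int_itv_finite _).1).1.
Qed.

Lemma int_ball_cardS n s (M : nat) : s < M.+1%:R ^+ 2 ->
  int_ball_card n.+1 s =
  (\sum_(k < 2 * M + 1) int_ball_card n (s - (k%:R - M%:R) ^+ 2)%R)%N.
Proof.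
move=> sM; rewrite {1}/int_ball_card.
pose f (a : 'rV[int]_n.+1) := a 0 ord0.
pose S := [seq k%:Z - M%:Z | k <- iota 0 (2 * M + 1)].
have us : uniq S by rewrite map_inj_uniq ?iota_uniq// => j k; lia.
rewrite (card_fibers (f := f) (@int_ball_finite n.+1 s) us); last first.
  move=> a /(int_ball_sub sM) /(_ ord0) /= h; apply/mapP.
  by exists (absz (f a + M%:Z)); rewrite ?mem_iota /f; lia.
rewrite /S big_map -[X in iota 0 X]subn0 -/(index_iota 0 (2 * M + 1)) big_mkord.
apply: eq_bigr => k _; apply/eqP; rewrite eqn_leq.
have kE : ((k%:Z - M%:Z)%:~R : R) = k%:R - M%:R by rewrite intrB.
apply/andP; split.
  apply: (card_inj_le (f := fun a : 'rV[int]_n.+1 => \row_i a 0 (lift ord0 i)) _ _ _).2.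
  - exact: int_ball_finite.
  - move=> a [+ fa]; rewrite /int_ball /= big_ord_recl -/(f a) fa kE -lerBrDl.
    by apply: le_trans; apply: ler_sum => i _; rewrite mxE.
  - move=> a b [_ fa] [_ fb] /rowP ab; apply/rowP => i.
    case: (unliftP ord0 i) => [j ->|->]; last by rewrite -/(f a) -/(f b) fa fb.
    by have := ab j; rewrite !mxE.
pose g (b : 'rV[int]_n) : 'rV[int]_n.+1 :=
  \row_i if unlift ord0 i is Some j then b 0 j else k%:Z - M%:Z.
apply: (card_inj_le (f := g) _ _ _).2.
- exact: finite_setIl (int_ball_finite _ _).
- move=> b; rewrite /int_ball /= => sb; split; last by rewrite /f /g /= mxE unlift_none.
  rewrite /int_ball /= big_ord_recl /g !mxE unlift_none kE -lerBrDl.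
  by apply: le_trans sb; apply: ler_sum => i _; rewrite mxE liftK.
- move=> a b _ _ /rowP ab; apply/rowP => i; have := ab (lift ord0 i).
  by rewrite !mxE liftK.
Qed.

Lemma int_ball_card_lt0 n s : s < 0 -> int_ball_card n s = 0%N.
Proof.
move=> s0; rewrite /int_ball_card (_ : int_ball s = set0) ?card0//.
apply/seteqP; split=> // a; rewrite /int_ball /= leNgt (lt_le_trans s0)//.
by apply: sumr_ge0 => i _; exact: sqr_ge0.
Qed.

Lemma int_ball_card_le n s s' : s <= s' -> (int_ball_card n s <= int_ball_card n s')%N.
Proof.
move=> ss; apply: card_sub; first exact: int_ball_finite.
by move=> a /le_trans; apply.
Qed.

Lemma int_ball_card0 s : 0 <= s -> int_ball_card 0 s = 1%N.
Proof.
move=> s0; rewrite /int_ball_card (_ : int_ball s = [set 0]).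
  by rewrite /card fset_set1 cardfs1.
apply/seteqP; split=> a; first by move=> _; apply/rowP => -[].
by move=> _; rewrite /int_ball /= big_ord0.
Qed.

(* Minkowski's inequality for [(a, sqrt (r^2 - a^2))] moved by [(1, n)]. *)
Lemma shifted_radius (a x r : R) (n : nat) : 0 <= r -> a ^+ 2 <= r ^+ 2 ->
  `|x - a| <= 1 ->
  x ^+ 2 + (Num.sqrt (r ^+ 2 - a ^+ 2) + n%:R) ^+ 2 <= (r + n.+1%:R) ^+ 2.
Proof.
move=> r0 ar xa; set q := Num.sqrt _.
have q0 : 0 <= q by exact: sqrtr_ge0.
have qq : q ^+ 2 = r ^+ 2 - a ^+ 2 by rewrite sqr_sqrtr// subr_ge0.
have qr : q <= r by rewrite -(@ler_pXn2r _ 2)// ?nnegrE// qq gerBl sqr_ge0.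
have aler : `|a| <= r by rewrite -(@ler_pXn2r _ 2)// ?nnegrE// real_normK// num_real.
have n0 : 0 <= n%:R :> R by [].
rewrite -natr1; move: (n%:R) n0 => N N0.
have xx : x ^+ 2 <= (`|a| + 1) ^+ 2.
  rewrite -[x ^+ 2]real_normK ?num_real// lerXn2r ?nnegrE ?addr_ge0//.
  by rewrite -lerBlDl (le_trans (lerB_dist _ _)).
have aa : `|a| ^+ 2 = a ^+ 2 by rewrite real_normK ?num_real.
have : N * q <= N * r by rewrite ler_wpM2l.
nra.
Qed.

(** Induction on the dimension. The lattice slice at a is compared with every real slice at x in [a,
    a + 1[. By [shifted_radius], passing from a to x costs one unit of radius beyond the n units of
    the induction hypothesis. *)
Lemma int_ball_card_le_vol n r : 0 <= r ->
  ((int_ball_card n (r ^+ 2))%:R%:E <= sqball_vol n ((r + n%:R) ^+ 2))%E.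
Proof.
elim: n r => [|n IH] r r0.
  by rewrite sqball_vol0 int_ball_card0 ?sqr_ge0.
have rM : r ^+ 2 < (Num.truncn r).+1%:R ^+ 2.
  by rewrite ltrXn2r// ?nnegrE// truncnS_gt.
set M := Num.truncn r in rM *.
rewrite (int_ball_cardS n rM) natr_sum sqball_volS.
apply: (@sum_le_integral _ (fun k => (int_ball_card n (r ^+ 2 - (k%:R - M%:R) ^+ 2))%:R) (- M%:R)).
- exact: sqball_slice_measurable.
- by move=> x; exact: sqball_vol_ge0.
- by [].
move=> k x kM x1 x2.
have [h|h] := ltP (r ^+ 2 - (k%:R - M%:R) ^+ 2) 0.
  by rewrite int_ball_card_lt0// sqball_vol_ge0.
rewrite -(sqr_sqrtr h); apply: le_trans (IH _ (sqrtr_ge0 _)) _.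
apply: sqball_vol_le; rewrite lerBrDl; apply: shifted_radius => //.
  by rewrite -subr_ge0.
by rewrite -natr1 in x2; rewrite ler_norml; lra.
Qed.

(** The same slicing in the other direction. [M] is now taken from the enlarged radius [r'], so that
    the unit steps cover [-M, M + 1[, outside of which the real slices are empty. *)
Lemma vol_le_int_ball_card n r : 0 <= r ->
  (sqball_vol n (r ^+ 2) <= (int_ball_card n ((r + n%:R) ^+ 2))%:R%:E)%E.
Proof.
elim: n r => [|n IH] r r0.
  by rewrite sqball_vol0 int_ball_card0 ?sqr_ge0.
set r' := r + n.+1%:R; have r'0 : 0 <= r' by rewrite addr_ge0.
have rM : r' ^+ 2 < (Num.truncn r').+1%:R ^+ 2.
  by rewrite ltrXn2r// ?nnegrE// truncnS_gt.
set M := Num.truncn r' in rM *.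
have r'M : r' < M%:R + 1 by rewrite natr1 truncnS_gt.
have rr' : r + 1 <= r' by rewrite lerD2l ler1n.
rewrite (int_ball_cardS n rM) natr_sum sqball_volS.
have gout x : r < `|x| -> sqball_vol n (r ^+ 2 - x ^+ 2) = 0%E.
  move=> h; rewrite sqball_vol_lt0// subr_lt0 -[x ^+ 2]real_normK ?num_real//.
  by rewrite ltrXn2r// ?nnegrE.
apply: (@integral_le_sum _ (fun k => (int_ball_card n (r' ^+ 2 - (k%:R - M%:R) ^+ 2))%:R) (- M%:R)).
- exact: sqball_slice_measurable.
- by move=> x; exact: sqball_vol_ge0.
- move=> x h; apply: gout; rewrite real_ltNge ?num_real// ler_norml.
  apply/negP => /andP[h1 h2]; case: h => h; first by lra.
  by move: h; rewrite natrD natrM; lra.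
move=> k x kM x1 x2.
have [h|h] := ltP r `|x|; first by rewrite gout.
have h2 : x ^+ 2 <= r ^+ 2.
  by rewrite -[x ^+ 2]real_normK ?num_real// lerXn2r// nnegrE.
rewrite -{1}[r ^+ 2 - _]sqr_sqrtr ?subr_ge0//.
apply: le_trans (IH _ (sqrtr_ge0 _)) _; rewrite lee_fin ler_nat.
apply: int_ball_card_le; rewrite lerBrDl; apply: shifted_radius => //.
by rewrite -natr1 in x2; rewrite ler_norml; lra.
Qed.

Lemma ball_volE n r : 0 <= r -> ball_vol n r = ball_const n * r ^+ n.
Proof.
move=> r0; rewrite /ball_vol -[lebesgue_tuple _]/(sqball_vol n (r ^+ 2)).
case: n => [|n]; first by rewrite sqball_vol0 sqr_ge0 /= mulr1.
by rewrite sqball_volE /= sqrtr_sqr ger0_norm.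
Qed.

Lemma int_ball_card_bounds n r : n%:R <= r ->
  ball_const n * (r - n%:R) ^+ n <= (int_ball_card n (r ^+ 2))%:R <=
  ball_const n * (r + n%:R) ^+ n.
Proof.
move=> nr; have r0 : 0 <= r by apply: le_trans nr.
have volE t : 0 <= t -> sqball_vol n (t ^+ 2) = (ball_const n * t ^+ n)%:E.
  case: n {nr} => [|n] t0; first by rewrite sqball_vol0 sqr_ge0 /= mulr1.
  by rewrite sqball_volE /= sqrtr_sqr ger0_norm.
rewrite -!lee_fin -!volE ?subr_ge0 ?addr_ge0//; apply/andP; split.
  by apply: le_trans (vol_le_int_ball_card _ _) _; rewrite ?subr_ge0// subrK.
exact: int_ball_card_le_vol.
Qed.

End BallVolume.

(** * Nonzero primes of a commutative ring *)

Section NonzeroPrimes.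
Context {A : comNzRingType}.
Implicit Types (p : nonzero_primes A) (x y : A).

Definition in_prime p : set A := val p.

Lemma prime0 p : in_prime p 0.
Proof. by have [[]] := set_valP p. Qed.

Lemma primeD p x y : in_prime p x -> in_prime p y -> in_prime p (x + y).
Proof. by have [[_ pD _] _ _ _] := set_valP p; exact: pD. Qed.

Lemma primeM p x y : in_prime p y -> in_prime p (x * y).
Proof. by have [[_ _ pM] _ _ _] := set_valP p; exact: pM. Qed.

Lemma primeN p x : in_prime p x -> in_prime p (- x).
Proof. by move=> px; rewrite -mulN1r; exact: primeM. Qed.

Lemma primeB p x y : in_prime p x -> in_prime p y -> in_prime p (x - y).
Proof. by move=> px py; apply: primeD => //; exact: primeN. Qed.

Lemma prime1 p : ~ in_prime p 1.
Proof. by have [] := set_valP p. Qed.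

Lemma primeMP p x y : in_prime p (x * y) -> in_prime p x \/ in_prime p y.
Proof. by have [_ _ pP _] := set_valP p; exact: pP. Qed.

Lemma prime_sum p (I : Type) (r : seq I) (P : pred I) (f : I -> A) :
  (forall i, P i -> in_prime p (f i)) -> in_prime p (\sum_(i <- r | P i) f i).
Proof.
by move=> fp; apply: big_ind => //; [exact: prime0|exact: primeD].
Qed.

Lemma prime_ext p p' : (forall x, in_prime p x <-> in_prime p' x) -> p = p'.
Proof. by move=> h; apply/val_inj/funext => x; apply/propext. Qed.

Definition residue p (x : A) : residue_ring p :=
  (\pi_{ideal_quot (prime_idealr_of p)}%qT x).

Lemma residueP p x y : residue p x = residue p y <-> in_prime p (x - y).
Proof.
rewrite /residue; split.
  move/eqP; rewrite -Quotient.idealrBE => /set_mem //.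
by move=> h; apply/eqP; rewrite -Quotient.idealrBE; apply/mem_set.
Qed.

Lemma residue_surj p (u : residue_ring p) : exists x, residue p x = u.
Proof. by exists (repr u); rewrite /residue reprK. Qed.

Lemma residues_finite p (X : set A) : finite_set X ->
  (forall a, exists2 x, X x & in_prime p (a - x)) ->
  finite_set [set: residue_ring p] /\ (abs_norm p <= card X)%N.
Proof.
move=> fX cover.
have rep (u : residue_ring p) : exists x, X x /\ residue p x = u.
  have [a <-] := residue_surj u; have [x Xx ax] := cover a.
  by exists x; split=> //; apply/esym/residueP.
pose g u := projT1 (cid (rep u)).
have gP u : X (g u) /\ residue p (g u) = u := projT2 (cid (rep u)).
apply: (card_inj_le (f := g)) => //; first by move=> u _; have [] := gP u.
by move=> u v _ _ uv; rewrite -(gP u).2 -(gP v).2 uv.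
Qed.

Section FiniteResidueRing.
Variable p : nonzero_primes A.
Hypothesis finp : finite_set [set: residue_ring p].

(** Pigeonhole principle: among [(abs_norm p).+1] elements two are congruent. Applied to the natural
    numbers it puts a positive integer into [p]; applied to the powers of x it inverts x. *)
Lemma incongruent_le (k : nat) (f : nat -> A) :
  (forall i j, (i < j < k)%N -> ~ in_prime p (f j - f i)) -> (k <= abs_norm p)%N.
Proof.
move=> fP; rewrite -[leqLHS]card_ord -card_finType.
apply: (card_inj_le (f := fun i : 'I_k => residue p (f i)) finp _ _).2 => //.
move=> i j _ _ ij; apply/val_inj; case: (ltngtP i j) => // h.
  by case: (fP i j); [rewrite h ltn_ord|apply/residueP].
by case: (fP j i); [rewrite h ltn_ord|apply/residueP].
Qed.

Lemma abs_norm_gt0 : (0 < abs_norm p)%N.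
Proof.
by apply: (@incongruent_le 1 (fun=> 0)) => i j /andP[/leq_ltn_trans h] /h.
Qed.

Lemma prime_nat_exists : exists q, [&& (0 < q)%N & (q <= abs_norm p)%N]
  /\ in_prime p q%:R.
Proof.
apply: contrapT => /forallNP h.
suff : ((abs_norm p).+1 <= abs_norm p)%N by rewrite ltnn.
apply: (@incongruent_le _ (fun i => i%:R)) => i j /andP[ij jN] pij; apply: (h (j - i)%N).
by split; [lia|rewrite natrB// ltnW].
Qed.

(** A finite domain is a field: two powers of [x] are congruent, and primality cancels the smaller
    one. *)
Lemma prime_inverse x : ~ in_prime p x -> exists y, in_prime p (x * y - 1).
Proof.
move=> px; have pX k : ~ in_prime p (x ^+ k).
  by elim: k => [|k IH]; [exact: prime1|rewrite exprS => /primeMP[]].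
apply: contrapT => /forallNP h.
suff : ((abs_norm p).+1 <= abs_norm p)%N by rewrite ltnn.
apply: (@incongruent_le _ (fun i => x ^+ i)) => i j /andP[ij _].
rewrite -(subnKC (ltnW ij)) exprD -[X in _ - X]mulr1 -mulrBr.
have -> : (j - i = (j - i).-1.+1)%N by rewrite prednK// subn_gt0.
by rewrite exprS => /primeMP[/pX|/h].
Qed.

End FiniteResidueRing.

(** An element of p' outside [p] is invertible modulo [p], and its product with the inverse is the
    required e. If there is none, then p' lies in [p]; an element of [p] outside p' would be
    invertible modulo p', which would force 1 into [p]. *)
Lemma primes_comaximal p p' : finite_set [set: residue_ring p] ->
  finite_set [set: residue_ring p'] -> p <> p' ->
  exists e, in_prime p' e /\ in_prime p (e - 1).
Proof.
move=> finp finp' pp'.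
have [sub|/existsNP[x /not_implyP[p'x px]]] :=
  pselect (forall x, in_prime p' x -> in_prime p x); last first.
  have [y xy] := prime_inverse finp px; exists (x * y); split=> //.
  by rewrite mulrC; exact: primeM.
exfalso; apply: pp'; apply: prime_ext => x; split; last exact: sub.
move=> px; apply: contrapT => /(prime_inverse finp')[y /sub xy].
apply: (@prime1 p); rewrite -(subKr (x * y) 1); apply: primeB => //.
by rewrite mulrC; exact: primeM.
Qed.

End NonzeroPrimes.

(** * Z-bases *)

Lemma rowBE (V : zmodType) (m : nat) (z x : 'rV[V]_m) i :
  (z - x) 0 i = z 0 i - x 0 i.
Proof. by rewrite !mxE. Qed.

Lemma rowDE (V : zmodType) (m : nat) (z x : 'rV[V]_m) i :
  (z + x) 0 i = z 0 i + x 0 i.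
Proof. by rewrite !mxE. Qed.

Section ZBasis.
Context {V : zmodType} {n : nat} {E : n.-tuple V}.
Hypothesis basisE : is_Zbasis E.

Definition of_zcoord (a : 'rV[int]_n) : V := \sum_i tnth E i *~ a 0 i.

Definition zcoord (x : V) : 'rV[int]_n := \row_i projT1 (cid (basisE.1 x)) i.

Lemma zcoordK : cancel zcoord of_zcoord.
Proof.
move=> x; rewrite /of_zcoord [RHS](projT2 (cid (basisE.1 x))).
by apply: eq_bigr => i _; rewrite mxE.
Qed.

Lemma of_zcoordB a b : of_zcoord (a - b) = of_zcoord a - of_zcoord b.
Proof.
by rewrite /of_zcoord -sumrB; apply: eq_bigr => i _; rewrite !mxE mulrzBr.
Qed.

Lemma of_zcoord_inj : injective of_zcoord.
Proof.
move=> a b ab; apply/rowP => i; apply/eqP; rewrite -subr_eq0.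
have := basisE.2 (fun i => (a - b) 0 i); rewrite -/(of_zcoord (a - b)).
by rewrite of_zcoordB ab subrr => /(_ erefl i); rewrite !mxE => ->.
Qed.

Lemma of_zcoordK : cancel of_zcoord zcoord.
Proof. by move=> a; apply: of_zcoord_inj; rewrite zcoordK. Qed.

Lemma zcoord_inj : injective zcoord.
Proof. exact: can_inj zcoordK. Qed.

Lemma zcoordB x y : zcoord (x - y) = zcoord x - zcoord y.
Proof. by apply: of_zcoord_inj; rewrite of_zcoordB !zcoordK. Qed.

Lemma zcoordBE x y i : zcoord (x - y) 0 i = zcoord x 0 i - zcoord y 0 i.
Proof. by rewrite zcoordB rowBE. Qed.

Lemma zcoordD x y : zcoord (x + y) = zcoord x + zcoord y.
Proof. by apply: (addIr (- zcoord y)); rewrite -zcoordB !addrK. Qed.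

Lemma zcoord_eq0 x : (forall i, zcoord x 0 i = 0) -> x = 0.
Proof.
move=> h; rewrite -[x]zcoordK /of_zcoord big1// => i _.
by rewrite h mulr0z.
Qed.

Lemma cubeP L x : cube E L x <-> forall i, `|zcoord x 0 i| <= L%:Z.
Proof.
split=> [[a aL xE] i|h]; last first.
  by exists (fun i => zcoord x 0 i); [move=> i; rewrite -ler_norml|rewrite -[LHS]zcoordK].
have -> : x = of_zcoord (\row_i a i).
  by rewrite xE; apply: eq_bigr => j _; rewrite mxE.
by rewrite of_zcoordK mxE ler_norml.
Qed.

Lemma ball_ptsP (R : realType) (r : R) x :
  ball_pts E r x <-> int_ball (r ^+ 2) (zcoord x).
Proof.
split=> [[a aL xE]|h]; last first.
  by exists (fun i => zcoord x 0 i); [exact: h|rewrite -[LHS]zcoordK].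
have -> : x = of_zcoord (\row_i a i).
  by rewrite xE; apply: eq_bigr => j _; rewrite mxE.
by rewrite of_zcoordK /int_ball /=; under eq_bigr do rewrite mxE.
Qed.

Lemma zcoord_card (X : set V) (Y : set 'rV[int]_n) : finite_set Y ->
  (forall x, X x <-> Y (zcoord x)) -> finite_set X /\ card X = card Y.
Proof.
move=> fY XY.
have [fX le1] : finite_set X /\ (card X <= card Y)%N.
  apply: (card_inj_le (f := zcoord)) => //; first by move=> x /XY.
  by move=> x y _ _ /zcoord_inj.
split=> //; apply/eqP; rewrite eqn_leq le1 /=.
apply: (card_inj_le (f := of_zcoord) fX _ _).2.
  by move=> a Ya; apply/XY; rewrite of_zcoordK.
by move=> a b _ _ /of_zcoord_inj.
Qed.

Lemma cube_card L : finite_set (cube E L) /\ card (cube E L) = ((2 * L + 1) ^ n)%N.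
Proof.
have [fI cI] := int_itv_finite L; have [fr cr] := card_rV_in n fI.
rewrite -cI -cr; apply: zcoord_card => // x; apply: (iff_trans (cubeP L x)).
by split=> h i; have := h i; rewrite /= ler_norml.
Qed.

Lemma ball_pts_card (R : realType) (r : R) :
  finite_set (ball_pts E r) /\ card (ball_pts E r) = int_ball_card n (r ^+ 2).
Proof.
by apply: zcoord_card; [exact: int_ball_finite|move=> x; exact: ball_ptsP].
Qed.

(* Distinct points whose coordinates all fall in the same block of length
   [t] would differ by less than [t] in every coordinate. *)
Lemma separated_card (X : set V) (L t : nat) : (0 < t)%N -> X `<=` cube E L ->
  (forall x y, X x -> X y -> (forall i, `|zcoord (x - y) 0 i| < t%:Z) -> x = y) ->
  (card X <= ((2 * L) %/ t + 1) ^ n)%N.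
Proof.
move=> t0 XL sep.
pose b x i := (absz (zcoord x 0 i + L%:Z)%R %/ t)%N.
have bL x i : X x -> (b x i < (2 * L) %/ t + 1)%N.
  move=> /XL /cubeP /(_ i) h; rewrite addn1 ltnS leq_div2r//; lia.
have -> : (((2 * L) %/ t + 1) ^ n)%N =
    card [set: {ffun 'I_n -> 'I_((2 * L) %/ t + 1)}].
  by rewrite card_finType card_ffun !card_ord.
have t1 : (0 < (2 * L) %/ t + 1)%N by rewrite addn1.
pose f x : {ffun 'I_n -> 'I_((2 * L) %/ t + 1)} :=
  [ffun i => insubd (Ordinal t1) (b x i)].
apply: (card_inj_le (f := f) _ _ _).2 => //; first exact: finite_finset.
move=> x y Xx Xy /ffunP fxy; apply: sep => // i.
have : b x i = b y i.
  by have := congr1 val (fxy i); rewrite !ffunE !val_insubd !bL.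
rewrite /b zcoordBE; move/XL/cubeP/(_ i): Xx; move/XL/cubeP/(_ i): Xy.
set u := zcoord x 0 i; set v := zcoord y 0 i => vL uL uv.
have := divn_eq (absz (u + L%:Z)) t; have := divn_eq (absz (v + L%:Z)) t.
rewrite uv; have := ltn_pmod (absz (u + L%:Z)%R) t0; have := ltn_pmod (absz (v + L%:Z)%R) t0.
set c := (_ * t)%N; move: (_ %% _)%N (_ %% _)%N vL uL => r1 r2; clear; lia.
Qed.

End ZBasis.

(** * Residue characteristics and the Chinese remainder theorem *)

Section PrimesAbove.
Context {A : comNzRingType} {n : nat} {E : n.-tuple A}.
Hypothesis basisE : is_Zbasis E.
Hypothesis fin_residue : forall p : nonzero_primes A, finite_set [set: residue_ring p].

Lemma least_nat_exists (p : nonzero_primes A) :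
  exists q, (0 < q)%N && `[< in_prime p q%:R >].
Proof.
by have [q [/andP[q0 _] pq]] := prime_nat_exists (fin_residue p); exists q;
  rewrite q0; apply/asboolP.
Qed.

(** The characteristic of the residue ring, encoded as a minimum because the arguments rest on
    minimality: smaller natural numbers are pairwise incongruent modulo [p]. *)
Definition residue_char (p : nonzero_primes A) : nat := ex_minn (least_nat_exists p).

Lemma residue_charP p : (1 < residue_char p <= abs_norm p)%N /\
  in_prime p (residue_char p)%:R.
Proof.
rewrite /residue_char; case: ex_minnP => q /andP[q0 /asboolP pq] qmin.
split=> //; apply/andP; split.
  rewrite ltn_neqAle q0 andbT eq_sym; apply/eqP => q1.
  by apply: (@prime1 _ p); rewrite q1 in pq.
have [q' [/andP[q'0 q'N] pq']] := prime_nat_exists (fin_residue p).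
by apply: leq_trans q'N; apply: qmin; rewrite q'0; apply/asboolP.
Qed.

Lemma residue_char_min p (k : nat) : (0 < k)%N -> in_prime p k%:R ->
  (residue_char p <= k)%N.
Proof.
move=> k0 pk; rewrite /residue_char; case: ex_minnP => q _; apply.
by rewrite k0; apply/asboolP.
Qed.

Lemma in_prime_nat_eq p (a b : nat) : (a < residue_char p)%N ->
  (b < residue_char p)%N -> in_prime p (a%:R - b%:R) -> a = b.
Proof.
move=> aq bq pab; case: (ltngtP a b) => // h.
  have := @residue_char_min p (b - a); rewrite subn_gt0 h natrB ?(ltnW h)//.
  rewrite -opprB => /(_ isT (primeN pab)) le; have := leq_ltn_trans (leq_subr a b) bq.
  by rewrite ltnNge le.
have := @residue_char_min p (a - b); rewrite subn_gt0 h natrB ?(ltnW h)//.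
move=> /(_ isT pab) le; have := leq_ltn_trans (leq_subr b a) aq.
by rewrite ltnNge le.
Qed.

(** Multiply the comaximality elements of [p] with each prime of [s]: the product stays 1 modulo [p]
    and lies in each of these primes. *)
Lemma crt_idempotent (s : seq (nonzero_primes A)) p : p \notin s ->
  exists e, in_prime p (e - 1) /\ forall p', p' \in s -> in_prime p' e.
Proof.
elim: s => [|p1 s IH]; first by exists 1; rewrite subrr; split=> //; exact: prime0.
rewrite inE negb_or => /andP[pp1 /IH[e [pe se]]].
have [e' [p1e' pe']] := primes_comaximal (fin_residue p) (fin_residue p1)
  (elimN eqP pp1).
exists (e' * e); split.
  have -> : e' * e - 1 = e' * (e - 1) + (e' - 1) by ring.
  by apply: primeD => //; exact: primeM.
move=> p'; rewrite inE => /predU1P[->|p's]; first by rewrite mulrC; exact: primeM.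
by apply: primeM; exact: se.
Qed.

(* With idempotents [e_i] modulo the primes [p_i], the sums [sum c_i e_i] with
   [0 <= c_i < q] are pairwise incongruent modulo [q], so that [q^k <= q^n]. *)
Lemma primes_above_le (q : nat) (s : seq (nonzero_primes A)) : uniq s ->
  (forall p, p \in s -> residue_char p = q) -> (size s <= n)%N.
Proof.
move=> us sq; case: (posnP (size s)) => [->//|s0].
pose P (i : 'I_(size s)) := tnth (in_tuple s) i.
have Ps i : P i \in s by exact: mem_tnth.
have Pinj i j : P i = P j -> i = j.
  rewrite /P !(tnth_nth (P i)) /= => /eqP.
  by rewrite nth_uniq ?ltn_ord// => /eqP/val_inj.
have q1 : (1 < q)%N.
  by rewrite -(sq _ (Ps (Ordinal s0))); have [/andP[]] := residue_charP (P (Ordinal s0)).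
have q0 : (0 < q)%N by exact: ltnW.
have idem i : exists e, in_prime (P i) (e - 1) /\ forall j, j != i -> in_prime (P j) e.
  have Pi : P i \notin rem (P i) s by rewrite mem_rem_uniq// inE eqxx.
  have [e [e1 e2]] := crt_idempotent Pi; exists e; split=> // j ji.
  apply: e2; rewrite mem_rem_uniq// inE Ps andbT.
  by apply: contra ji => /eqP/Pinj ->.
pose e i := projT1 (cid (idem i)).
have [e1 e2] : (forall i, in_prime (P i) (e i - 1)) /\
    (forall i j, j != i -> in_prime (P j) (e i)).
  by split=> i; have [] := projT2 (cid (idem i)).
pose F (c : {ffun 'I_(size s) -> 'I_q}) : A := \sum_i (c i)%:R * e i.
(* [G] reads the class of [F c] modulo q on its coordinates. Equal values make the difference a
   multiple of q, hence an element of every [P i], where [F c] reduces to [c i]. *)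
pose G (c : {ffun 'I_(size s) -> 'I_q}) : {ffun 'I_n -> 'I_q} :=
  [ffun i => insubd (Ordinal q0) (absz (modz (zcoord basisE (F c) 0 i) q))].
have Ginj : injective G.
  move=> c d /ffunP Gcd.
  have [w Fw] : exists w, F c - F d = q%:R * w.
    exists (of_zcoord (E := E) (\row_i divz (zcoord basisE (F c - F d) 0 i) q)).
    rewrite -[LHS](zcoordK basisE) /of_zcoord mulr_sumr; apply: eq_bigr => i _.
    rewrite mxE mulr_natl pmulrn -mulrzA divzK//.
    rewrite zcoordBE -eqz_mod_dvd; apply/eqP.
    have := congr1 val (Gcd i); rewrite !ffunE !val_insubd.
    have qz : (0 < q%:Z)%R by [].
    have hmod (a : int) : (absz (a %% q)%Z < q)%N.
      have := modz_ge0 a (lt0r_neq0 qz); have := ltz_pmod a qz; lia.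
    rewrite !hmod.
    have := modz_ge0 (zcoord basisE (F c) 0 i) (lt0r_neq0 qz).
    have := modz_ge0 (zcoord basisE (F d) 0 i) (lt0r_neq0 qz).
    lia.
  apply/ffunP => i; apply/val_inj/(@in_prime_nat_eq (P i)); rewrite ?sq//.
  - exact: ltn_ord.
  - exact: ltn_ord.
  have pF : in_prime (P i) (F c - F d).
    by rewrite Fw mulrC; apply: primeM; rewrite -(sq _ (Ps i)); exact: (residue_charP _).2.
  have Fmod (b : {ffun 'I_(size s) -> 'I_q}) : in_prime (P i) (F b - (b i)%:R).
    rewrite /F (bigD1 i)//= addrAC -[X in _ - X]mulr1 -mulrBr.
    apply: primeD; first by apply: primeM; exact: e1.
    by apply: prime_sum => j ji; apply: primeM; apply: e2; rewrite eq_sym.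
  rewrite (_ : _ - _ = (F c - F d) - (F c - (c i)%:R) + (F d - (d i)%:R)).
    by apply: primeD => //; exact: primeB.
  by ring.
have := leq_card G Ginj; rewrite !card_ffun !card_ord leq_exp2l//.
Qed.

End PrimesAbove.

(** * Rings of integers *)

Section NumberField.
Context {K : fieldExtType rat} {n : nat} {E : n.-tuple (ringint K)}.
Hypothesis dimK : \dim {:K} = n.
Hypothesis basisE : is_Zbasis E.
Local Notation A := (ringint K).

Let e (i : 'I_n) : K := val (tnth E i).
Let X : n.-tuple K := [tuple e i | i < n].

Lemma nth_Kbasis (i : 'I_n) : X`_i = e i.
Proof. by rewrite -tnth_nth tnth_mktuple. Qed.

Lemma val_of_zcoord (a : 'rV[int]_n) :
  val (of_zcoord (E := E) a) = \sum_i (a 0 i)%:~R *: e i.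
Proof.
rewrite /of_zcoord raddf_sum; apply: eq_bigr => i _.
by rewrite raddfMz scaler_int.
Qed.

(** A rational relation times the product [d] of its denominators is an integral relation, so it is
    trivial. *)
Lemma Kbasis_free : free X.
Proof.
apply/freeP => k k0 i.
pose d : int := \prod_j denq (k j).
have d0 : d%:~R != 0 :> rat.
  by rewrite intr_eq0 prodf_seq_neq0; apply/allP => j _; rewrite denq_neq0.
pose a : 'rV[int]_n := \row_j (numq (k j) * \prod_(l | l != j) denq (k l)).
have aE j : (a 0 j)%:~R = d%:~R * k j :> rat.
  have -> : d = denq (k j) * \prod_(l | l != j) denq (k l) by rewrite /d (bigD1 j).
  rewrite mxE !rmorphM /= mulrAC; congr (_ * _).
  by rewrite numqE mulrC.
have a0 : of_zcoord (E := E) a = 0.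
  apply: val_inj; rewrite val_of_zcoord.
  under eq_bigr do rewrite aE -scalerA -nth_Kbasis.
  by rewrite -scaler_sumr k0 scaler0.
have := basisE.2 _ a0 i => ai; have := aE i; rewrite ai => /esym/eqP.
by rewrite mulf_eq0 (negPf d0) => /eqP.
Qed.

Lemma Kbasis_basis : basis_of {:K}%VS X.
Proof. by rewrite basisEfree Kbasis_free subvf dimK size_tuple leqnn. Qed.

Lemma coord_val (a : A) i : coord X i (val a) = (zcoord basisE a 0 i)%:~R.
Proof.
rewrite -[in LHS](zcoordK basisE a) val_of_zcoord.
under eq_bigr do rewrite -nth_Kbasis.
by rewrite coord_sum_free// Kbasis_free.
Qed.

(** All structure constants of the multiplication in the basis, summed in absolute value. A product
    of factors with coordinates at most d and at most 1 has coordinates at most [mul_height * d];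
    summing over [k] too gives one bound for all coordinates. *)
Definition mul_height : nat :=
  (\sum_k \sum_j \sum_i absz (zcoord basisE (tnth E j * tnth E i)%R 0%R k))%N.

(* [a / x] is rounded down to the lattice point [q]; the remainder is [x] times
   an element with coordinates in [0, 1[. *)
Lemma division_remainder (x a : A) (d : nat) : x != 0 ->
  (forall i, `|zcoord basisE x 0 i| <= d%:Z) ->
  exists q, forall k, `|zcoord basisE (a - x * q) 0 k| <= (mul_height * d)%N%:Z.
Proof.
move=> x0 xd; pose y : K := val a / val x.
pose fl i : int := Num.floor (coord X i y).
pose f i : rat := coord X i y - (fl i)%:~R.
have f01 i : 0 <= f i <= 1.
  have /andP[f1 f2] := floor_itv (coord X i y).
  by rewrite subr_ge0 f1 lerBlDl ltW//; move: f2; rewrite intrD.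
exists (of_zcoord (E := E) (\row_i fl i)) => k; set q := of_zcoord _.
have vx0 : val x != 0 :> K.
  by apply: contra x0 => /eqP vx; apply/eqP/val_inj; rewrite vx.
have valr : val (a - x * q) = \sum_j \sum_i
    ((zcoord basisE x 0 j)%:~R * f i) *: val (tnth E j * tnth E i) :> K.
  have -> : val (a - x * q) = val x * \sum_i f i *: e i :> K.
    have -> : \sum_i f i *: e i = y - val q.
      rewrite {1}(coord_basis Kbasis_basis (memvf y)) val_of_zcoord -sumrB.
      by apply: eq_bigr => i _; rewrite nth_Kbasis mxE scalerBl.
    by rewrite mulrBr [val x * y]mulrC /y divfK// rmorphB rmorphM.
  rewrite -[in LHS](zcoordK basisE x) val_of_zcoord mulr_suml.
  apply: eq_bigr => j _; rewrite mulr_sumr; apply: eq_bigr => i _.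
  by rewrite -scalerAl -scalerAr scalerA rmorphM.
have coordr : coord X k (val (a - x * q)) = \sum_j \sum_i
    (zcoord basisE x 0 j)%:~R * f i *
      (zcoord basisE (tnth E j * tnth E i) 0 k)%:~R.
  rewrite valr linear_sum; apply: eq_bigr => j _.
  rewrite linear_sum; apply: eq_bigr => i _.
  by rewrite linearZ; congr (_ * _); exact: coord_val.
rewrite -(ler_int rat) intr_norm -coord_val coordr.
apply: le_trans (ler_norm_sum _ _ _) _.
rewrite /mul_height -[leRHS]/((_ * d)%N%:R) natrM natr_sum mulr_suml.
rewrite [leRHS](bigD1 k)//= -[leLHS]addr0; apply: lerD; last first.
  by apply: sumr_ge0 => i _; rewrite mulr_ge0.
rewrite natr_sum mulr_suml; apply: ler_sum => j _.
rewrite natr_sum mulr_suml.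
apply: le_trans (ler_norm_sum _ _ _) _; apply: ler_sum => i _.
rewrite !normrM [leRHS]mulrC.
have /andP[f0 f1] := f01 i.
rewrite natr_absz intr_norm ler_wpM2r// -[leRHS]mulr1 ler_pM//.
  by have := xd j; rewrite -(ler_int rat) intr_norm.
by rewrite ger0_norm.
Qed.

(** The remainders of a division fill a cube of (2 h d + 1)^n points with h = [mul_height]. For d >
    0 this is at most ((2 h + 1) d)^n. *)
Definition norm_const : nat := (2 * mul_height + 1)%N.

Lemma abs_norm_le (p : nonzero_primes A) (x : A) (d : nat) : in_prime p x ->
  x != 0 -> (forall i, `|zcoord basisE x 0 i| <= d%:Z) ->
  finite_set [set: residue_ring p] /\ (abs_norm p <= (norm_const * d) ^ n)%N.
Proof.
move=> px x0 xd; have [fC cC] := cube_card basisE (mul_height * d).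
have d0 : (0 < d)%N.
  rewrite lt0n; apply: contra x0 => /eqP d0; apply/eqP/(zcoord_eq0 (basisE := basisE)).
  by move=> i; have := xd i; rewrite d0 normr_le0 => /eqP.
have [|fp le] := @residues_finite _ p _ fC.
  move=> a; have [q qP] := division_remainder a x0 xd.
  exists (a - x * q); first by apply/cubeP.
  by rewrite opprB addrC subrK mulrC; exact: primeM.
split=> //; apply: leq_trans le _; rewrite cC.
case: (n) => [|n']//; rewrite leq_exp2r// /norm_const mulnA mulnDl leq_add2l.
by rewrite mul1n.
Qed.

Lemma residue_ring_finite (p : nonzero_primes A) : finite_set [set: residue_ring p].
Proof.
have [_ _ _ [x px x0]] := set_valP p.
pose d := (\sum_i absz (zcoord basisE x 0%R i))%N.
apply: (abs_norm_le (d := d) px x0 _).1 => i.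
by rewrite -abszE lez_nat /d (bigD1 i)//= leq_addr.
Qed.

Lemma degree_gt0 : (0 < n)%N.
Proof. by rewrite -dimK adim_gt0. Qed.

Lemma congruent_eq (p : nonzero_primes A) (L : nat) x y :
  cube E L x -> cube E L y -> in_prime p (x - y) ->
  ((norm_const * (2 * L)) ^ n < abs_norm p)%N -> x = y.
Proof.
move=> /(cubeP basisE) xL /(cubeP basisE) yL pxy ltN.
apply/eqP; rewrite -subr_eq0; apply/negPn/negP => xy0.
have [i|_ le] := @abs_norm_le p (x - y) (2 * L) pxy xy0.
  by have := xL i; have := yL i; rewrite zcoordBE; lia.
by move: ltN; rewrite ltnNge le.
Qed.

Definition congruence_class (p : nonzero_primes A) (x : A) : set A :=
  [set z | in_prime p (z - x)].

(** Let [t] be least with N(p) <= (C t)^n. Distinct congruent points differ by at least [t] in some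
    coordinate, since otherwise [abs_norm_le] with t - 1 would contradict minimality. So
    [separated_card] applies. *)
Lemma congruence_class_card (p : nonzero_primes A) (L : nat) x :
  (abs_norm p <= (norm_const * (2 * L)) ^ n)%N ->
  (card (cube E L `&` congruence_class p x) * abs_norm p <=
    (4 * norm_const * L) ^ n)%N.
Proof.
move=> leN; have N0 := abs_norm_gt0 (residue_ring_finite p).
have n0 := degree_gt0.
have ext : exists t, (abs_norm p <= (norm_const * t) ^ n)%N by exists (2 * L)%N.
case: (ex_minnP ext) => t tN tmin.
have t0 : (0 < t)%N.
  rewrite lt0n; apply/eqP => t0; move: tN; rewrite t0 muln0 exp0n//.
  by rewrite leqNgt N0.
have tL : (t <= 2 * L)%N by exact: tmin.
have le1 : (card (cube E L `&` congruence_class p x) <=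
    ((2 * L) %/ t + 1) ^ n)%N.
  apply: (separated_card (basisE := basisE) t0); first by move=> z [].
  move=> u v [uL pu] [vL pv] uv.
  apply/eqP; rewrite -subr_eq0; apply/negPn/negP => uv0.
  have puv : in_prime p (u - v).
    have -> : u - v = (u - x) - (v - x) by rewrite opprB addrA subrK.
    exact: primeB.
  have [i|_ le] := @abs_norm_le p (u - v) t.-1 puv uv0.
    by have := uv i; lia.
  have := tmin _ le; lia.
(* Per coordinate, (2 L / t + 1) C t <= C (2 L + t) <= 4 C L, because t <= 2 L. *)
apply: leq_trans (leq_mul le1 tN) _; rewrite -expnMn leq_exp2r//.
have := leq_trunc_div (2 * L) t.
set w := (_ %/ _)%N => wt; nia.
Qed.

End NumberField.

(** * Visibility and Euler factors *)

Section Visibility.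
Context {A : comNzRingType}.

Lemma maximal_ideal_exists (I : set A) : is_ideal I -> ~ I 1 ->
  exists M, [/\ is_ideal M, ~ M 1, I `<=` M &
    forall N, is_ideal N -> ~ N 1 -> M `<=` N -> N `<=` M].
Proof.
move=> idI I1.
pose P (M : set A) := M = set0 \/ [/\ is_ideal M, ~ M 1 & I `<=` M].
have [|M [PM maxM]] := @Zorn_bigcup _ P.
  move=> F FP totF; have [[X0 FX0 [x0 X0x0]]|none] :=
    pselect (exists2 X, F X & exists x, X x); last first.
    left; apply/seteqP; split=> // x [X FX Xx]; apply: none.
    by exists X => //; exists x.
  have idX X x : F X -> X x -> [/\ is_ideal X, ~ X 1 & I `<=` X].
    by move=> /FP[->|].
  have [[X00 _ _] _ IX0] := idX _ _ FX0 X0x0.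
  right; split=> //; last by move=> x Ix; exists X0 => //; exact: IX0.
    split; first by exists X0.
      move=> x y [X FX Xx] [Y FY Yy].
      have [XY|YX] := totF _ _ FX FY.
        exists Y => //; have [[_ YD _] _ _] := idX _ _ FY Yy.
        by apply: YD => //; exact: XY.
      exists X => //; have [[_ XD _] _ _] := idX _ _ FX Xx.
      by apply: XD => //; exact: YX.
    move=> a x [X FX Xx]; exists X => //.
    by have [[_ _ XM] _ _] := idX _ _ FX Xx; exact: XM.
  by move=> [X FX X1]; have [_ []] := idX _ _ FX X1.
have [M0|[idM M1 IM]] := PM.
  exfalso; apply: (maxM I); last by right; split.
  rewrite M0; split=> // I0; have [I00 _ _] := idI; exact: I0 I00.
exists M; split=> // N idN N1 MN; apply: contrapT => NM.
apply: (maxM N); first by split.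
by right; split=> //; apply: subset_trans MN.
Qed.

Lemma maximal_ideal_prime (M : set A) : is_ideal M -> ~ M 1 ->
  (forall N, is_ideal N -> ~ N 1 -> M `<=` N -> N `<=` M) ->
  forall x y, M (x * y) -> M x \/ M y.
Proof.
move=> [M0 MD MM] M1 maxM x y Mxy; have [Mx|nMx] := pselect (M x); first by left.
right; pose N : set A := [set z | exists a b, M a /\ z = a + b * x].
have idN : is_ideal N.
  split; first by exists 0, 0; rewrite mul0r addr0.
    move=> _ _ [a [b [Ma ->]]] [c [d [Mc ->]]]; exists (a + c), (b + d).
    by split; [exact: MD|ring].
  move=> c _ [a [b [Ma ->]]]; exists (c * a), (c * b).
  by split; [exact: MM|ring].
have [[a [b [Ma ab]]]|N1] := pselect (N 1); last first.
  exfalso; apply: nMx; apply: (maxM N) => //.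
    by move=> z Mz; exists z, 0; rewrite mul0r addr0.
  by exists 0, 1; rewrite mul1r add0r.
have -> : y = y * a + b * (x * y) by rewrite -[LHS]mulr1 ab; ring.
by apply: MD; exact: MM.
Qed.

Lemma gcd_ideal_is_ideal (m : nat) (a : 'rV[A]_m) : is_ideal (gcd_ideal a).
Proof.
split; first by move=> I [[]].
  move=> x y hx hy I hI; have [[_ ID _] _] := hI.
  by apply: ID; [exact: hx|exact: hy].
by move=> c x hx I hI; have [[_ _ IM] _] := hI; apply: IM; exact: hx.
Qed.

Lemma gcd_ideal_mem (m : nat) (a : 'rV[A]_m) i : gcd_ideal a (a 0 i).
Proof. by move=> I [_]; apply; exists i => //; exists 1; rewrite ?mulr1. Qed.

Lemma gcd_ideal_sub_prime (m : nat) (a : 'rV[A]_m) (p : nonzero_primes A) :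
  (forall i, in_prime p (a 0 i)) -> gcd_ideal a `<=` in_prime p.
Proof.
move=> pa; apply: smallest_sub; first by have [] := set_valP p.
by move=> x [i _ [c _ <-]]; rewrite mulrC; exact: primeM.
Qed.

(** Outside [S] the gcd ideal contains a nonzero coordinate of z - x. If it is proper, a maximal
    ideal above it is therefore among the nonzero primes. *)
Lemma visibleP (m : nat) (S : set 'rV[A]_m) (z : 'rV[A]_m) : ~ S z ->
  visible S z <-> forall p x, S x -> ~ (forall i, in_prime p ((z - x) 0 i)).
Proof.
move=> Sz; split=> [vis p x Sx /gcd_ideal_sub_prime sub|h x Sx].
  by apply: (@prime1 _ p); apply: sub; rewrite vis.
apply: contrapT => gT.
have g1 : ~ gcd_ideal (z - x) 1.
  move=> g1; apply: gT; apply/seteqP; split=> // c _.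
  by rewrite -[c]mulr1; have [_ _] := gcd_ideal_is_ideal (z - x); apply.
have [M [idM M1 gM maxM]] := maximal_ideal_exists (gcd_ideal_is_ideal (z - x)) g1.
have [i zxi] : exists i, (z - x) 0 i != 0.
  apply: contrapT => /forallNP zx; apply: Sz; suff -> : z = x by [].
  apply/rowP => i; apply/eqP; rewrite -subr_eq0; apply/negPn/negP => zxi.
  by apply: (zx i); rewrite !mxE.
have Mp : nonzero_primes A M.
  split=> //; first exact: maximal_ideal_prime.
  by exists ((z - x) 0 i) => //; apply: gM; exact: gcd_ideal_mem.
apply: (h (exist _ M (mem_set Mp)) x Sx) => j.
by apply: gM; exact: gcd_ideal_mem.
Qed.

(** This direction covers the points of [S] too, so the upper bound on the density has no
    exceptional set. *)
Lemma visible_away (m : nat) (S : set 'rV[A]_m) (z : 'rV[A]_m) p x :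
  visible S z -> S x -> ~ (forall i, in_prime p ((z - x) 0 i)).
Proof.
move=> vis Sx /gcd_ideal_sub_prime sub.
by apply: (@prime1 _ p); apply: sub; rewrite vis.
Qed.

Lemma proj_modP (m : nat) p (z x : 'rV[A]_m) :
  proj_mod p z = proj_mod p x <-> forall i, in_prime p ((z - x) 0 i).
Proof.
split=> [/rowP h i|h].
  by have := h i; rewrite !mxE => /residueP.
by apply/rowP => i; rewrite !mxE; apply/residueP; have := h i; rewrite !mxE.
Qed.

Definition visible_mod (m : nat) (S : set 'rV[A]_m) (s : seq (nonzero_primes A)) :
  set 'rV[A]_m :=
  [set z | forall p x, p \in s -> S x -> ~ (forall i, in_prime p ((z - x) 0 i))].

End Visibility.

Section EulerFactors.
Context {R : realType} {A : comNzRingType} {m : nat}.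
Variable S : set 'rV[A]_m.
Hypothesis m_gt0 : (0 < m)%N.

Lemma residue_vectors_card (p : nonzero_primes A) :
  finite_set [set: residue_ring p] ->
  finite_set [set: 'rV[residue_ring p]_m] /\
  card [set: 'rV[residue_ring p]_m] = (abs_norm p ^ m)%N.
Proof.
move=> /(card_rV_in m); rewrite /abs_norm.
have -> // : rV_in [set: residue_ring p] = [set: 'rV[residue_ring p]_m].
by apply/seteqP; split.
Qed.

Lemma euler_factor_ge0_le1 (p : nonzero_primes A) :
  0 <= euler_factor R S p <= 1.
Proof.
rewrite /euler_factor.
(* For an infinite residue ring [card] gives norm 0; as m > 0 the quotient is a division by 0, hence
   0, and the factor is 1. *)
have [fp|infp] := pselect (finite_set [set: residue_ring p]); last first.
  rewrite (_ : abs_norm p = 0%N).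
    by rewrite expr0n gtn_eqF// invr0 mulr0 subr0 ler01 lexx.
  rewrite /abs_norm /card /fset_set.
  by case: pselect => // f; case: infp.
have [fU cU] := residue_vectors_card fp.
have N0 : 0 < (abs_norm p)%:R ^+ m :> R by rewrite exprn_gt0// ltr0n abs_norm_gt0.
apply/andP; split; last by rewrite gerBl divr_ge0// exprn_ge0.
rewrite subr_ge0 ler_pdivrMr// mul1r -natrX ler_nat -cU.
by apply: card_sub.
Qed.

End EulerFactors.

(* Infinite products of factors in [0, 1] *)
#[local] Existing Instance totally_filter.

Section InfiniteProduct.
Context {R : realType} {I : choiceType} {f : I -> R}.
Hypothesis f01 : forall i, 0 <= f i <= 1.

Lemma partial_prod_ge0 (J : {fset I}) : 0 <= partial_prod f J.
Proof. by apply: prodr_ge0 => i _; have /andP[] := f01 i. Qed.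

Lemma partial_prod_anti (J J' : {fset I}) : (J `<=` J')%fset ->
  partial_prod f J' <= partial_prod f J.
Proof.
move=> /fsubsetP JJ'; rewrite /partial_prod.
rewrite [leLHS](perm_big (J ++ [seq x <- J' | x \notin J])) /=; last first.
  apply: uniq_perm; first exact: fset_uniq.
    rewrite cat_uniq fset_uniq filter_uniq ?fset_uniq// andbT.
    by apply/hasPn => x; rewrite mem_filter => /andP[].
  move=> x; rewrite mem_cat mem_filter.
  by case: (boolP (x \in J)) => [/JJ' ->|].
rewrite big_cat /= ler_piMr//.
  by apply: prodr_ge0 => i _; have /andP[] := f01 i.
by apply: prodr_ile1 => i _; exact: f01.
Qed.

(** Factors in [0, 1] make the partial products decrease along inclusion of finite sets, so their
    limit, possibly 0, is the infimum. *)
Lemma partial_prod_cvg : partial_prod f @ totally --> inf (range (partial_prod f)).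
Proof.
have hlb : has_lbound (range (partial_prod f)).
  by exists 0 => _ [J _ <-]; exact: partial_prod_ge0.
have hinf : has_inf (range (partial_prod f)).
  by split=> //; exists (partial_prod f fset0), fset0.
apply/cvgrPdist_le => /= eps eps0.
have [_ [J _ <-] JD] := inf_adherent eps0 hinf.
exists J => // J' /= JJ'.
rewrite distrC ger0_norm ?subr_ge0; last by apply: ge_inf => //; exists J'.
by rewrite lerBlDl (le_trans (partial_prod_anti JJ'))// ltW.
Qed.

Lemma infprod_is_cvg : infprod_cvg f.
Proof. by apply/cvg_ex; exists (inf (range (partial_prod f))); exact: partial_prod_cvg. Qed.

Lemma infprodE : infprod f = inf (range (partial_prod f)).
Proof. by apply/cvg_lim => //; exact: partial_prod_cvg. Qed.

Lemma infprod_le J : infprod f <= partial_prod f J.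
Proof.
rewrite infprodE; apply: ge_inf; last by exists J.
by exists 0 => _ [J' _ <-]; exact: partial_prod_ge0.
Qed.

Lemma infprod_adherent eps : 0 < eps ->
  exists J, partial_prod f J < infprod f + eps.
Proof.
move=> eps0; have hinf : has_inf (range (partial_prod f)).
  split; first by exists (partial_prod f fset0), fset0.
  by exists 0 => _ [J _ <-]; exact: partial_prod_ge0.
by have [_ [J _ <-] JD] := inf_adherent eps0 hinf; exists J; rewrite infprodE.
Qed.

End InfiniteProduct.

(** * Primes of large residue characteristic *)

(** Telescoping: 1/(b + 1)^2 <= 1/(b (b + 1)) = 1/b - 1/(b + 1). *)
Lemma sum_inv_sq_le (R : realType) (a k : nat) : (0 < a)%N ->
  \sum_(a.+1 <= q < a.+1 + k) (q%:R ^+ 2)^-1 <= a%:R^-1 - (a + k)%:R^-1 :> R.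
Proof.
move=> a0; elim: k => [|k IH]; first by rewrite addn0 big_geq// addn0 subrr.
rewrite addnS big_nat_recr ?leq_addr//=.
apply: le_trans (lerD IH (lexx _)) _.
rewrite addSn addnS -[(a + k).+1%:R]natr1; set b : R := (a + k)%:R.
have b0 : 0 < b by rewrite ltr0n addn_gt0 a0.
clearbody b.
have : ((b + 1) ^+ 2)^-1 <= b^-1 - (b + 1)^-1; last by lra.
have -> : b^-1 - (b + 1)^-1 = (b * (b + 1))^-1.
  have bn : b != 0 by rewrite gt_eqF.
  have b1n : b + 1 != 0 by rewrite gt_eqF// addr_gt0.
  by field; rewrite bn b1n.
rewrite lef_pV2 ?posrE ?exprn_gt0 ?mulr_gt0 ?addr_gt0//.
by rewrite expr2 ler_wpM2r// ?addr_ge0 ?lerDl// ltW.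
Qed.

Section Tail.
Context {R : realType} {K : fieldExtType rat} {n m : nat} {E : n.-tuple (ringint K)}.
Hypothesis dimK : \dim {:K} = n.
Hypothesis basisE : is_Zbasis E.
Hypothesis m_ge2 : (2 <= m)%N.
Local Notation A := (ringint K).

Let finr := residue_ring_finite dimK basisE.
Local Notation rchar := (residue_char finr).

Lemma primes_finite (Q : nat) :
  finite_set [set p : nonzero_primes A | (rchar p <= Q)%N].
Proof.
have -> : [set p : nonzero_primes A | (rchar p <= Q)%N] =
    \bigcup_(q in `I_Q.+1) [set p : nonzero_primes A | rchar p = q].
  apply/seteqP; split=> [p pQ|p [q qQ pq]]; first by exists (rchar p).
  by move: qQ; rewrite /= pq ltnS.
apply: bigcup_finite; first exact: finite_II.
move=> q _; apply: contrapT => /(@infinite_set_fset _ _ n.+1)[B Bq nB].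
have := @primes_above_le _ _ _ basisE finr q (B : seq _) (fset_uniq B).
move=> /(_ Bq); rewrite leqNgt => /negP; apply; exact: nB.
Qed.

Lemma sum_abs_norm_le (s : seq (nonzero_primes A)) (Y : nat) : (0 < Y)%N ->
  uniq s -> (forall p, p \in s -> (Y < rchar p)%N) ->
  \sum_(p <- s) ((abs_norm p)%:R ^+ m)^-1 <= n%:R / Y%:R :> R.
Proof.
move=> Y0 us sY.
have [k sk] : exists k, forall p, p \in s -> (rchar p < Y.+1 + k)%N.
  exists (\sum_(p <- s) rchar p)%N => p ps.
  by rewrite (big_rem p)//=; lia.
pose g (q : nat) : R := (q%:R ^+ 2)^-1.
apply: (@le_trans _ _ (\sum_(p <- s) g (rchar p))).
  apply: ler_sum => p _; have [/andP[q1 qN] _] := residue_charP finr p.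
  have q0 : (0 < rchar p)%N by exact: ltnW.
  rewrite /g lef_pV2 ?posrE ?exprn_gt0 ?ltr0n//; last exact: leq_trans qN.
  apply: (@le_trans _ _ ((rchar p)%:R ^+ m)).
    by rewrite ler_weXn2l// ler1n.
  by rewrite lerXn2r ?nnegrE// ler_nat.
(* Each term becomes a sum over q with a single nonempty index. After exchanging the sums, the inner
   one counts the primes of residue characteristic q. *)
have -> : \sum_(p <- s) g (rchar p) =
    \sum_(p <- s) \sum_(Y.+1 <= q < Y.+1 + k | q == rchar p) g q.
  rewrite [LHS]big_seq [RHS]big_seq; apply: eq_bigr => p ps.
  rewrite -big_filter (perm_big [:: rchar p]) ?big_seq1//.
  apply: uniq_perm => //; first by rewrite filter_uniq// iota_uniq.
  move=> q; rewrite mem_filter inE mem_index_iota.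
  by case: eqVneq => // ->; rewrite sY// sk.
rewrite (exchange_big_dep xpredT)//=.
apply: (@le_trans _ _ (\sum_(Y.+1 <= q < Y.+1 + k) n%:R * g q)).
  apply: ler_sum => q _.
  rewrite big_const_seq iter_addr_0 -[leLHS]mulr_natl; apply: ler_wpM2r.
    by rewrite /g invr_ge0 exprn_ge0.
  rewrite ler_nat -size_filter.
  apply: (primes_above_le basisE (fin_residue := finr) (q := q)); first exact: filter_uniq.
  by move=> p; rewrite mem_filter => /andP[/eqP].
rewrite -mulr_sumr ler_wpM2l//.
apply: le_trans (sum_inv_sq_le R k Y0) _.
by rewrite lerBlDr lerDl invr_ge0.
Qed.

(** Points of [S] are left out because each is congruent to itself modulo every prime. *)
Definition late_meeting (S : set 'rV[A]_m) (Y : nat) : set 'rV[A]_m :=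
  [set z | ~ S z /\ exists p x,
     [/\ (Y < rchar p)%N, S x & forall i, in_prime p ((z - x) 0 i)]].

Lemma late_meeting_card (S : set 'rV[A]_m) (Y L : nat) : (0 < Y)%N ->
  finite_set S -> S `<=` rV_in (cube E L) ->
  (card (rV_in (cube E L) `&` late_meeting S Y))%:R <=
    (card S)%:R * (((8 * norm_const basisE) ^ n) ^ m)%:R *
      (L%:R ^+ n) ^+ m * (n%:R / Y%:R) :> R.
Proof.
move=> Y0 fS SL; set C := norm_const basisE.
(* The primes modulo which a class may contain two points of the cube. The norm bounds the residue
   characteristic, so there are finitely many. *)
pose PP := [set p : nonzero_primes A |
  (Y < rchar p)%N /\ (abs_norm p <= (C * (2 * L)) ^ n)%N].
have fPP : finite_set PP.
  apply: sub_finite_set (primes_finite ((C * (2 * L)) ^ n)) => p [_].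
  by apply: leq_trans; have [/andP[]] := residue_charP finr p.
pose s : seq (nonzero_primes A) := fset_set PP.
have sP p : p \in s -> PP p by rewrite in_fset_set// => /set_mem.
pose M := ((4 * C * (2 * L)) ^ n)%N.
pose T (x : 'rV[A]_m) (p : nonzero_primes A) : set 'rV[A]_m :=
  rV_in (cube E L) `&` [set z | forall i, in_prime p ((z - x) 0 i)].
have fcube : finite_set (rV_in (m := m) (cube E L)).
  exact: (card_rV_in m (cube_card basisE L).1).1.
have fT x p : finite_set (T x p) by exact: finite_setIl.
have cT x p : S x -> PP p -> (card (T x p))%:R <= (M ^ m)%:R / (abs_norm p)%:R ^+ m :> R.
  move=> Sx [_ pN]; have fp := finr p.
  have N0 : 0 < (abs_norm p)%:R ^+ m :> R by rewrite exprn_gt0// ltr0n abs_norm_gt0.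
  rewrite ler_pdivlMr// -natrX -natrM ler_nat.
  (* Subtracting x moves the class of x to the zero class, and the cube of size [L] into that of
     size [2 * L]. *)
  pose X := cube E (2 * L) `&` congruence_class p 0.
  have fX : finite_set X by apply: finite_setIl; exact: (cube_card basisE _).1.
  have [fXm cXm] := card_rV_in m fX.
  apply: (@leq_trans (card X ^ m * abs_norm p ^ m)); last first.
    rewrite -expnMn /M; case: (m) => // m'; rewrite leq_exp2r//.
    apply: congruence_class_card => //; apply: leq_trans pN _.
    rewrite leq_exp2r ?(degree_gt0 dimK)// leq_mul2l leq_mul2l.
    by apply/orP; right; rewrite leq_pmull.
  rewrite leq_mul2r -cXm; apply/orP; right.
  apply: (card_inj_le (f := fun z => z - x) fXm _ _).2.
    move=> z [zL zx] i; split; last by rewrite /congruence_class /= subr0.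
    apply/(cubeP basisE) => j; rewrite rowBE zcoordBE.
    have /(cubeP basisE)/(_ j) := zL i; have /(cubeP basisE)/(_ j) := SL x Sx i; lia.
  by move=> y z _ _ /addIr.
have cover : rV_in (cube E L) `&` late_meeting S Y `<=`
    \bigcup_(u in [set` allpairs (fun x p => (x, p)) (fset_set S : seq _) s])
      T u.1 u.2.
  move=> z [zL [Sz [p [x [pY Sx zx]]]]].
  exists (x, p) => //=; apply/allpairsP; exists (x, p); split=> //=.
    by rewrite in_fset_set//; apply/mem_set.
  rewrite /s in_fset_set//; apply/mem_set; split=> //; rewrite leqNgt.
  (* For a larger norm, [z] and x are congruent points of one cube, hence equal, and [z] would lie
     in [S]. *)
  apply/negP => ltN; apply: Sz; suff -> : z = x by [].
  apply/rowP => i; apply: (congruent_eq dimK (basisE := basisE) (p := p) (L := L)) => //.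
    exact: SL.
  by have := zx i; rewrite !mxE.
have [fU cU] := card_bigcup_le (X := fun u => T u.1 u.2)
  (s := allpairs (fun x p => (x, p)) (fset_set S : seq _) s) (fun u _ => fT _ _).
apply: (@le_trans _ _ (\sum_(u <- allpairs (fun x p => (x, p)) (fset_set S : seq _) s)
    (card (T u.1 u.2))%:R)).
  by rewrite -natr_sum ler_nat; apply: leq_trans cU; exact: card_sub.
rewrite big_allpairs /=.
apply: (@le_trans _ _ (\sum_(x <- fset_set S) (M ^ m)%:R * (n%:R / Y%:R))).
  rewrite big_seq [leRHS]big_seq; apply: ler_sum => x xS.
  have Sx : S x by move: xS; rewrite in_fset_set// => /set_mem.
  apply: (@le_trans _ _ (\sum_(p <- s) (M ^ m)%:R / (abs_norm p)%:R ^+ m)).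
    by rewrite big_seq [leRHS]big_seq; apply: ler_sum => p /sP; exact: cT.
  rewrite -mulr_sumr ler_wpM2l//; apply: sum_abs_norm_le => //.
    exact: fset_uniq.
  by move=> p /sP[].
rewrite big_const_seq count_predT iter_addr_0 -[leLHS]mulr_natl.
have -> : (M ^ m)%N = (((8 * C) ^ n) ^ m * (L ^ n) ^ m)%N.
  by rewrite /M (_ : 4 * C * (2 * L) = 8 * C * L)%N ?(expnMn _ L) ?expnMn//; lia.
by rewrite natrM !natrX !mulrA.
Qed.

End Tail.

(** * Density of the visible points *)

Section Density.
Context {R : realType} {K : fieldExtType rat} {n m : nat} {E : n.-tuple (ringint K)}.
Hypothesis dimK : \dim {:K} = n.
Hypothesis basisE : is_Zbasis E.
Hypothesis m_ge2 : (2 <= m)%N.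
Local Notation A := (ringint K).
Variable S : set 'rV[A]_m.
Hypothesis finS : finite_set S.

Let finr := residue_ring_finite dimK basisE.
Local Notation rchar := (residue_char finr).
Local Notation euler := (@euler_factor R A m S).

Context {I : Type} {F : set_system I} {B : I -> set 'rV[A]_m} {v : I -> R}.
Context {FF : ProperFilter F}.
Local Notation avg := (average B v).

Hypothesis finB : forall i, finite_set (B i).
Hypothesis v_gt0 : \forall i \near F, 0 < v i.
Hypothesis averageT : avg setT @ F --> (1 : R).
Hypothesis folner : forall w : 'rV[A]_m, exists2 t : I -> I,
  (fun i => (card (B (t i)))%:R / v i) @ F --> (1 : R) &
  \forall i \near F, B i `<=` B (t i) /\ (forall z, B i z -> B (t i) (z + w)).

Lemma euler_factorE (p : nonzero_primes A) :
  (card (~` (proj_mod p @` S)))%:R /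
    (card [set: 'rV[residue_ring p]_m])%:R = euler p.
Proof.
have [fU cU] := residue_vectors_card (m := m) (finr p).
have N0 : (card [set: 'rV[residue_ring p]_m])%:R != 0 :> R.
  by rewrite cU natrX expf_neq0// pnatr_eq0 -lt0n abs_norm_gt0.
have := card_setDK fU (@subsetT _ (proj_mod p @` S)); rewrite setTD => cD.
have -> : (card (~` (proj_mod p @` S)))%:R =
    (card [set: 'rV[residue_ring p]_m])%:R - (residues S p)%:R :> R.
  by rewrite cD natrD addrC addKr.
by rewrite mulrBl divff// /euler_factor cU natrX.
Qed.

Lemma visible_mod_cons p s : visible_mod S (p :: s) =
  visible_mod S s `&` proj_mod p @^-1` (~` (proj_mod p @` S)).
Proof.
apply/seteqP; split=> z.
  move=> h; split=> [p' x p's|[x Sx /esym/proj_modP]].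
    by apply: h; rewrite inE p's orbT.
  by apply: h => //; exact: mem_head.
move=> [h hp] p' x; rewrite inE => /predU1P[->|]; last exact: h.
by move=> Sx /proj_modP zx; apply: hp; exists x.
Qed.

Lemma visible_mod_density s : uniq s ->
  avg (visible_mod S s) @ F --> \prod_(p <- s) euler p.
Proof.
elim: s => [_|p s IH /= /andP[ps us]].
  by rewrite big_nil; have -> // : visible_mod S [::] = setT by apply/seteqP; split.
rewrite visible_mod_cons big_cons mulrC -euler_factorE.
apply: average_equidistribution => //.
  exact: (residue_vectors_card (finr p)).1.
  move=> u u'; have [e [pe se]] := crt_idempotent finr ps.
  have lift (y : 'rV[residue_ring p]_m) : exists a : 'rV[A]_m, proj_mod p a = y.
    have h i : exists x, residue p x = y 0 i by exact: residue_surj.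
    exists (\row_i projT1 (cid (h i))); apply/rowP => i; rewrite !mxE.
    exact: projT2 (cid (h i)).
  have [a au] := lift u; have [a' au'] := lift u'.
  (* Modulo p this is a' - a, which carries the class [u] to [u']. It vanishes modulo the primes of
     s, so [visible_mod S s] is preserved. *)
  pose w := e *: (a' - a); exists w => z.
  have wE i : w 0 i = e * (a' 0 i - a 0 i) by rewrite /w !mxE.
  have far p' x i : p' \in s ->
      in_prime p' ((z + w - x) 0 i) <-> in_prime p' ((z - x) 0 i).
    move=> p's; have pw : in_prime p' (w 0 i).
      by rewrite wE mulrC; apply: primeM; exact: se.
    have -> : (z + w - x) 0 i = (z - x) 0 i + w 0 i by rewrite !mxE addrAC.
    split=> [h|h]; last exact: primeD.
    by rewrite -(addrK (w 0 i) ((z - x) 0 i)); exact: primeB.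
  have near : proj_mod p z = u <-> proj_mod p (z + w) = u'.
    rewrite -au -au'; split=> /proj_modP h; apply/proj_modP => i; have := h i.
      have -> : (z + w - a') 0 i = (z - a) 0 i + (a' 0 i - a 0 i) * (e - 1).
        by rewrite [LHS]mxE [(z + w) 0 i]mxE wE !rowBE mxE; ring.
      by move=> hi; apply: primeD => //; exact: primeM.
    have -> : (z + w - a') 0 i = (z - a) 0 i + (a' 0 i - a 0 i) * (e - 1).
      by rewrite [LHS]mxE [(z + w) 0 i]mxE wE !rowBE mxE; ring.
    move=> hi; rewrite -(addrK ((a' 0 i - a 0 i) * (e - 1)) ((z - a) 0 i)).
    by apply: primeB => //; exact: primeM.
  split=> -[vis zu]; split; try exact/near.
    by move=> p' x p's Sx h; apply: (vis p' x p's Sx) => i; apply/(far _ _ _ p's).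
  by move=> p' x p's Sx h; apply: (vis p' x p's Sx) => i; apply/(far _ _ _ p's).
exact: IH.
Qed.

Hypothesis v_inv : (fun i => (v i)^-1) @ F --> (0 : R).
(** For the tail, [B i] only has to lie in a cube of comparable volume, so the count in cubes serves
    both averaging families. *)
Variables (L : I -> nat) (c : R).
Hypothesis L_cvg : forall k : nat, \forall i \near F, (k <= L i)%N.
Hypothesis B_cube : \forall i \near F,
  B i `<=` rV_in (cube E (L i)) /\ ((L i)%:R ^+ n) ^+ m <= c * v i.

Lemma average_le (T T' : set 'rV[A]_m) i : 0 < v i -> T `<=` T' ->
  avg T i <= avg T' i.
Proof.
move=> vi TT'; rewrite /average ler_pM2r ?invr_gt0// ler_nat.
by apply: card_sub; [exact: finite_setIl|exact: setIS].
Qed.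

Lemma averageU_le (T T' : set 'rV[A]_m) i : 0 < v i ->
  avg (T `|` T') i <= avg T i + avg T' i.
Proof.
move=> vi; rewrite /average -mulrDl ler_pM2r ?invr_gt0// -natrD ler_nat setIUr.
by apply: card_setU_le; exact: finite_setIl.
Qed.

Lemma S_in_cube : exists k, forall l, (k <= l)%N -> S `<=` rV_in (cube E l).
Proof.
exists (\sum_(x <- fset_set S) \sum_i \sum_j absz (zcoord basisE (x 0%R i) 0%R j))%N.
move=> l kl x Sx i; apply/(cubeP basisE) => j.
have xS : x \in (fset_set S : seq _) by rewrite in_fset_set//; exact/mem_set.
rewrite -abszE lez_nat; apply: leq_trans kl.
rewrite (big_rem x)//= (bigD1 i)//= (bigD1 j)//= -!addnA; exact: leq_addr.
Qed.

Lemma late_meeting_average (eps : R) : 0 < eps -> exists2 Y : nat, (0 < Y)%N &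
  \forall i \near F, avg (late_meeting dimK basisE S Y) i <= eps.
Proof.
move=> eps0.
pose a : R := (card S)%:R * (((8 * norm_const basisE) ^ n) ^ m)%:R * `|c| * n%:R.
have a0 : 0 <= a by rewrite !mulr_ge0.
pose Y := (Num.truncn (a / eps)).+1.
exists Y => //; have Y0 : 0 < Y%:R :> R by rewrite ltr0n.
have aY : a / Y%:R <= eps.
  by rewrite ler_pdivrMr// mulrC -ler_pdivrMr// ltW// truncnS_gt.
have [k kS] := S_in_cube.
near=> i.
have vi : 0 < v i by near: i.
have [Bi Li] : B i `<=` rV_in (cube E (L i)) /\ ((L i)%:R ^+ n) ^+ m <= c * v i.
  by near: i.
have ki : (k <= L i)%N by near: i; exact: L_cvg.
apply: le_trans aY; rewrite /average ler_pdivrMr//.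
have fcube := (card_rV_in m (cube_card basisE (L i)).1).1.
apply: le_trans (_ : _ <= (card (rV_in (cube E (L i)) `&` late_meeting dimK basisE S Y))%:R) _.
  by rewrite ler_nat; apply: card_sub; [exact: finite_setIl|exact: setSI].
apply: le_trans (late_meeting_card dimK basisE m_ge2 (ltn0Sn _) finS (kS _ ki)) _.
have Lc : ((L i)%:R ^+ n) ^+ m <= `|c| * v i.
  by apply: le_trans Li _; rewrite ler_pM2r// ler_norm.
rewrite /a -!mulrA ler_wpM2l// ler_wpM2l// !mulrA.
rewrite [leRHS](_ : _ = `|c| * v i * (n%:R / Y%:R)); last by ring.
by rewrite -mulrA ler_wpM2r// divr_ge0.
Unshelve. all: by end_near. Qed.

Lemma visible_density : avg (visible S) @ F --> infprod euler.
Proof.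
have f01 p : 0 <= euler p <= 1 by apply: euler_factor_ge0_le1; exact: ltnW.
apply/cvgrPdist_le => eps eps0.
have e30 : 0 < eps / 3 by rewrite divr_gt0.
have [J0 J0D] := infprod_adherent f01 e30.
have [Y Y0 latee] := late_meeting_average e30.
pose PY := [set p : nonzero_primes A | (rchar p <= Y)%N].
have fPY : finite_set PY := primes_finite dimK basisE Y.
(* [J0] brings the partial product close to its limit, and the primes of [PY] ensure that every
   point still failing visibility is late or in [S]. The three errors are the partial-product
   average, [S] and the late points. *)
pose J : {fset nonzero_primes A} := (J0 `|` fset_set PY)%fset.
have DJ := infprod_le f01 J.
have JD : partial_prod euler J <= infprod euler + eps / 3.
  apply: le_trans (ltW J0D); apply: (partial_prod_anti f01); exact: fsubsetUl.
have /cvgrPdist_le/(_ _ e30) cJ := visible_mod_density (fset_uniq J).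
have cS : (fun i => (card S)%:R * (v i)^-1) @ F --> ((card S)%:R * 0 : R).
  exact: cvgMr.
rewrite mulr0 in cS; move/cvgrPdist_le/(_ _ e30): cS => cS.
near=> i.
have vi : 0 < v i by near: i.
have c1 : `|partial_prod euler J - avg (visible_mod S J) i| <= eps / 3 by near: i.
have c2 : avg (late_meeting dimK basisE S Y) i <= eps / 3 by near: i.
have c3 : `|0 - (card S)%:R * (v i)^-1| <= eps / 3 by near: i.
have le1 : avg (visible S) i <= avg (visible_mod S J) i.
  by apply: average_le => // z vis p x pJ Sx; exact: visible_away vis Sx.
have sub : visible_mod S J `<=` visible S `|` (S `|` late_meeting dimK basisE S Y).
  move=> z zJ; have [Sz|Sz] := pselect (S z); first by right; left.
  have [late|nlate] := pselect (late_meeting dimK basisE S Y z); first by right; right.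
  left; apply/(visibleP Sz) => p x Sx zx.
  have [pY|pY] := leqP (rchar p) Y.
    apply: (zJ p x) => //; rewrite inE; apply/orP; right.
    by rewrite in_fset_set//; apply/mem_set.
  by apply: nlate; split=> //; exists p, x.
have le2 : avg (visible_mod S J) i <=
    avg (visible S) i + (avg S i + avg (late_meeting dimK basisE S Y) i).
  apply: le_trans (average_le vi sub) _; apply: le_trans (averageU_le _ _ vi) _.
  by rewrite lerD2l averageU_le.
have le3 : avg S i <= (card S)%:R * (v i)^-1.
  by rewrite /average ler_pM2r ?invr_gt0// ler_nat; apply: card_sub.
rewrite sub0r normrN ger0_norm ?mulr_ge0 ?invr_ge0 ?(ltW vi)// in c3.
by move: c1; rewrite !ler_norml => /andP[]; lra.
Unshelve. all: by end_near. Qed.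

End Density.

(** * Cubes and balls as averaging sets *)

Section Averages.
Context {R : realType} {K : fieldExtType rat} {n m : nat} {E : n.-tuple (ringint K)}.
Hypothesis dimK : \dim {:K} = n.
Hypothesis basisE : is_Zbasis E.
Hypothesis m_ge2 : (2 <= m)%N.
Local Notation A := (ringint K).

Definition coord_height (w : 'rV[A]_m) : nat :=
  (\sum_i \sum_j absz (zcoord basisE (w 0%R i) 0%R j))%N.

Lemma coord_heightP (w : 'rV[A]_m) i j : `|zcoord basisE (w 0 i) 0 j| <= (coord_height w)%:Z.
Proof.
rewrite -abszE lez_nat /coord_height (bigD1 i)//= (bigD1 j)//= -addnA.
exact: leq_addr.
Qed.

Lemma cvg_expr (I : Type) (F : set_system I) {FF : Filter F} (f : I -> R) (l : R) k :
  f @ F --> l -> (fun i => f i ^+ k) @ F --> l ^+ k.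
Proof.
move=> fl; apply: (@continuous_cvg _ _ _ _ _ _ (fun x : R => x ^+ k)) => //.
exact: exprn_continuous.
Qed.

Lemma cvg_natr_inv : (fun L : nat => (L%:R)^-1) @ \oo --> (0 : R).
Proof.
have := @cvg_harmonic R.
by rewrite (cvg_shiftS (fun L : nat => L%:R^-1 : R)).
Qed.

Lemma cube_ratio_cvg (k : nat) :
  (fun L : nat => (((2 * (L + k) + 1) ^ n) ^ m)%:R / ((2 * L)%:R ^+ n) ^+ m)
    @ \oo --> (1 : R).
Proof.
have h : (fun L : nat => ((1 + (2 * k + 1)%:R / 2 * (L%:R)^-1) ^+ n) ^+ m) @ \oo -->
    (((1 + (2 * k + 1)%:R / 2 * 0) ^+ n) ^+ m : R).
  do 2 apply: cvg_expr; apply: cvgD; first exact: cvg_cst.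
  by apply: cvgMr; exact: cvg_natr_inv.
rewrite mulr0 addr0 !expr1n in h; apply: cvg_trans h; apply: near_eq_cvg.
near=> L; have L0 : (0 < L)%N by near: L; exact: nbhs_infty_gt.
have Ln : L%:R != 0 :> R by rewrite pnatr_eq0 -lt0n.
rewrite !natrX -!expr_div_n; congr ((_ ^+ _) ^+ _).
by rewrite !(natrD, natrM); field.
Unshelve. all: by end_near. Qed.

Lemma cube_density (S : set 'rV[A]_m) : finite_set S ->
  density_cube E (visible S) (infprod (@euler_factor R A m S)).
Proof.
move=> finS; have m0 : (0 < m)%N by exact: ltnW.
have n0 := degree_gt0 dimK.
pose v (L : nat) : R := ((2 * L)%:R ^+ n) ^+ m.
have cardB L : finite_set (rV_in (m := m) (cube E L)) /\
    card (rV_in (m := m) (cube E L)) = (((2 * L + 1) ^ n) ^ m)%N.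
  have [fC cC] := cube_card basisE L; have [fr cr] := card_rV_in m fC.
  by rewrite cr cC.
have ratio k : (fun L : nat => (card (rV_in (m := m) (cube E (L + k))))%:R / v L) @ \oo --> (1 : R).
  by under eq_fun do rewrite (cardB _).2; exact: cube_ratio_cvg.
have v_gt0 : \forall L \near \oo, 0 < v L.
  near=> L; rewrite /v !exprn_gt0// ltr0n muln_gt0 /=; near: L.
  exact: nbhs_infty_gt.
apply: (@visible_density R K n m E dimK basisE m_ge2 S finS nat \oo
  (fun L => rV_in (cube E L)) v _ _ v_gt0 _ _ _ id 1).
- by move=> L; exact: (cardB L).1.
- have := ratio 0%N; apply: cvg_trans; apply: near_eq_cvg; near=> L.
  by rewrite /average setIT addn0.
- move=> w; exists (fun L => L + coord_height w)%N; first exact: ratio.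
  near=> L; split=> [z zL i|z zL i]; apply/(cubeP basisE) => j.
    by have /(cubeP basisE)/(_ j) := zL i; lia.
  rewrite rowDE zcoordD rowDE PoszD; apply: le_trans (ler_normD _ _) _.
  apply: lerD; last exact: coord_heightP.
  by have /(cubeP basisE)/(_ j) := zL i.
- have h : (fun L : nat => ((2^-1 * (L%:R)^-1) ^+ n) ^+ m) @ \oo -->
    (((2^-1 * 0) ^+ n) ^+ m : R).
    by do 2 apply: cvg_expr; apply: cvgMr; exact: cvg_natr_inv.
  rewrite mulr0 expr0n gtn_eqF// expr0n gtn_eqF// in h; apply: cvg_trans h.
  apply: near_eq_cvg; near=> L.
  by rewrite /v natrM -!exprVn invfM.
- by move=> k; exact: nbhs_infty_ge.
- near=> L; split=> //; rewrite mul1r /v; do 2 (rewrite lerXn2r ?nnegrE ?exprn_ge0//).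
  by rewrite ler_nat leq_pmull.
Unshelve. all: by end_near. Qed.

Lemma cvg_real_inv : (fun r : R => r^-1) @ +oo --> (0 : R).
Proof.
have pos : \forall r \near +oo, (0 : R) < r by exact: nbhs_pinfty_gt.
exact/(gtr0_cvgV0 pos).
Qed.

(** The volume constant cancels, and the lattice count bounds squeeze the ratio between n-th powers
    of 1 + (k - n)/r and 1 + (k + n)/r. *)
Lemma ball_ratio_cvg (k : R) : 0 <= k ->
  (fun r : R => ((int_ball_card n ((r + k) ^+ 2) ^ m)%N)%:R / ball_vol n r ^+ m)
    @ +oo --> (1 : R).
Proof.
move=> k0; have V0 := @ball_const_gt0 R n.
have lim (t : R) : (fun r : R => (1 + t * r^-1) ^+ n) @ +oo --> (1 : R).
  have h : (fun r : R => (1 + t * r^-1) ^+ n) @ +oo --> ((1 + t * 0) ^+ n : R).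
    apply: cvg_expr; apply: cvgD; first exact: cvg_cst.
    by apply: cvgMr; exact: cvg_real_inv.
  by rewrite mulr0 addr0 expr1n in h.
suff h : (fun r : R => (int_ball_card n ((r + k) ^+ 2))%:R / ball_vol n r) @ +oo --> (1 : R).
  have hm : (fun r : R => ((int_ball_card n ((r + k) ^+ 2))%:R / ball_vol n r) ^+ m)
    @ +oo --> (1 ^+ m : R) by exact: cvg_expr.
  rewrite expr1n in hm.
  by under eq_fun do rewrite natrX -expr_div_n.
apply: (@squeeze_cvgr _ _ _ _ (fun r => (1 + (k - n%:R) * r^-1) ^+ n)
  (fun r => (1 + (k + n%:R) * r^-1) ^+ n)) => //.
near=> r.
have nr : n%:R <= r by near: r; exact: nbhs_pinfty_ge.
have r0 : 0 < r by near: r; exact: nbhs_pinfty_gt.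
have rn : r != 0 by rewrite gt_eqF.
have nrk : n%:R <= r + k by rewrite (le_trans nr)// lerDl.
have /andP[lo hi] := int_ball_card_bounds nrk.
rewrite (ball_volE n (ltW r0)).
move: (ball_const n) ((int_ball_card n _)%:R) V0 lo hi => V N V0 lo hi.
have scale t : (1 + t * r^-1) ^+ n = (r + t) ^+ n / r ^+ n.
  by rewrite -expr_div_n mulrDl divff.
have rn0 : 0 < r ^+ n by rewrite exprn_gt0.
have lo' : (r + (k - n%:R)) ^+ n <= V^-1 * N by rewrite ler_pdivlMl// addrA.
have hi' : V^-1 * N <= (r + (k + n%:R)) ^+ n by rewrite ler_pdivrMl// addrA.
by rewrite !scale invfM mulrA [N * _]mulrC !ler_pM2r ?invr_gt0// lo' hi'.
Unshelve. all: by end_near. Qed.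

(* A crude triangle inequality: the Euclidean norm of [w] is at most [n b]. *)
Lemma int_ball_shift (x w : 'rV[int]_n) (b : nat) (r : R) : (0 < n)%N -> 0 <= r ->
  int_ball (r ^+ 2) x -> (forall j, `|w 0 j| <= b%:Z) ->
  int_ball ((r + (n * b)%:R) ^+ 2) (x + w).
Proof.
move=> n0 r0; rewrite /int_ball /= => xr wb.
have xj j : `|(x 0 j)%:~R| <= r :> R.
  rewrite -(@ler_pXn2r _ 2)// ?nnegrE// real_normK ?num_real//.
  apply: le_trans xr; rewrite (bigD1 j)//= lerDl.
  by apply: sumr_ge0 => i _; exact: sqr_ge0.
have wj j : `|(w 0 j)%:~R| <= b%:R :> R.
  by rewrite -intr_norm -[b%:R]/(b%:Z%:~R) ler_int.
apply: (@le_trans _ _ (\sum_j ((x 0 j)%:~R ^+ 2 + (2 * r * b%:R + b%:R ^+ 2)))).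
  apply: ler_sum => j _; rewrite mxE intrD sqrrD -addrA lerD2l.
  have := xj j; have := wj j; move: ((x 0 j)%:~R) ((w 0 j)%:~R) => X W Wb Xr.
  apply: lerD.
    rewrite -[_ *+ 2]mulr_natl -mulrA ler_wpM2l//.
    by apply: le_trans (ler_norm _) _; rewrite normrM ler_pM.
  by rewrite -[W ^+ 2]real_normK ?num_real// lerXn2r ?nnegrE.
rewrite big_split /= sumr_const card_ord.
apply: le_trans (lerD xr (lexx _)) _.
rewrite sqrrD natrM -addrA lerD2l mulrnDl; apply: lerD.
  rewrite -[leLHS]mulr_natr -[leRHS]mulr_natr.
  by rewrite [leLHS](_ : _ = r * (n%:R * b%:R) * 2)//; ring.
rewrite -[leLHS]mulr_natl exprMn ler_wpM2r ?sqr_ge0//.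
by rewrite expr2 ler_peMl// ler1n.
Qed.

Lemma ball_density (S : set 'rV[A]_m) : finite_set S ->
  density_ball E (visible S) (infprod (@euler_factor R A m S)).
Proof.
move=> finS; have m0 : (0 < m)%N by exact: ltnW.
have n0 := degree_gt0 dimK.
pose v (r : R) : R := ball_vol n r ^+ m.
have V0 := @ball_const_gt0 R n.
have cardB (r : R) : finite_set (rV_in (m := m) (ball_pts E r)) /\
    card (rV_in (m := m) (ball_pts E r)) = (int_ball_card n (r ^+ 2) ^ m)%N.
  have [fC cC] := ball_pts_card basisE r; have [fr cr] := card_rV_in m fC.
  by rewrite cr cC.
have ratio (k : R) : 0 <= k ->
    (fun r : R => (card (rV_in (m := m) (ball_pts E (r + k))))%:R / v r) @ +oo --> (1 : R).
  by move=> k0; under eq_fun do rewrite (cardB _).2; exact: ball_ratio_cvg.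
have v_gt0 : \forall r \near +oo, 0 < v r.
  near=> r; have r0 : 0 < r by near: r; exact: nbhs_pinfty_gt.
  by rewrite /v exprn_gt0// ball_volE ?(ltW r0)// mulr_gt0// exprn_gt0.
(* The ball of radius r lies in the cube of size [Num.truncn r], and r^n is the ball volume divided
   by [ball_const n]. Taking m-th powers gives the constant. *)
apply: (@visible_density R K n m E dimK basisE m_ge2 S finS R +oo
  (fun r => rV_in (ball_pts E r)) v _ _ v_gt0 _ _ _ (@Num.truncn R)
  ((ball_const n : R) ^- m)).
- by move=> r; exact: (cardB r).1.
- have := ratio 0 (lexx 0); apply: cvg_trans; apply: near_eq_cvg; near=> r.
  by rewrite /average setIT addr0.
- move=> w; exists (fun r => r + (n * coord_height w)%:R); first exact: ratio.
  near=> r; have r0 : 0 <= r by near: r; exact: nbhs_pinfty_ge.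
  split=> [z zr i|z zr i]; apply/(ball_ptsP basisE).
    have /(ball_ptsP basisE) := zr i; rewrite /int_ball /= => h; apply: le_trans h _.
    by rewrite lerXn2r ?nnegrE ?addr_ge0// lerDl.
  rewrite rowDE zcoordD; apply: int_ball_shift => //.
    exact/(ball_ptsP basisE).
  by move=> j; exact: coord_heightP.
- have h : (fun r : R => ((ball_const n)^-1 * (r^-1) ^+ n) ^+ m) @ +oo -->
    (((ball_const n)^-1 * 0 ^+ n) ^+ m : R).
    by apply: cvg_expr; apply: cvgMr; apply: cvg_expr; exact: cvg_real_inv.
  rewrite expr0n gtn_eqF// mulr0 expr0n gtn_eqF// in h; apply: cvg_trans h.
  apply: near_eq_cvg; near=> r; have r0 : 0 <= r by near: r; exact: nbhs_pinfty_ge.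
  by rewrite /v ball_volE// -exprVn invfM exprVn.
- move=> k; near=> r; rewrite -(@natrK R k); apply: le_truncn.
  by near: r; exact: nbhs_pinfty_ge.
- near=> r; have r0 : 0 <= r by near: r; exact: nbhs_pinfty_ge.
  split=> [z zr i|].
    apply/(cubeP basisE) => j; rewrite ler_norml.
    have /(ball_ptsP basisE) h := zr i; apply: (int_ball_sub _ h).
    by rewrite ltrXn2r// ?nnegrE// truncnS_gt.
  rewrite /v ball_volE// exprMn mulKf ?expf_neq0 ?gt_eqF//.
  do 2 (rewrite lerXn2r ?nnegrE ?exprn_ge0//).
  by rewrite truncn_le.
Unshelve. all: by end_near. Qed.

End Averages.

Theorem theorem1p3 (R : realType) (K : fieldExtType rat) (n m : nat)
    (S : set 'rV[ringint K]_m) :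
  \dim {:K} = n ->
  principal_ideal_ring (ringint K) ->
  (2 <= m)%N ->
  finite_set S ->
  infprod_cvg (@euler_factor R _ _ S) /\
  (forall E : n.-tuple (ringint K), is_Zbasis E ->
     density_cube E (visible S) (infprod (@euler_factor R _ _ S)) /\
     density_ball E (visible S) (infprod (@euler_factor R _ _ S))).
Proof.
move=> dimK _ m_ge2 finS; split.
  by apply: infprod_is_cvg => p; apply: euler_factor_ge0_le1; exact: ltnW.
move=> E basisE; split; [exact: cube_density|exact: ball_density].
Qed.
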